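(* Let $\Gamma=\langle R_1,R_2,R_3\rangle$ be any of the lattices in ${\rm PU}(2,1)$ constructed by Deraux, Parker and Paupert, that is, any of the groups in the list (1)--(5) of the context, with the exception of the groups of family (5) (denoted $\mathcal{T}(p,{\bf E}_2)$) with $p=3,6,12$. Then $\Gamma$ is commensurable to the monodromy group of a third order hypergeometric equation.
   Context: **Reflection groups.** For an integer $p$ with $|p|\ge 2$ and $\rho,\sigma,\tau\in\mathbb{C}$ let $$R_1=\begin{pmatrix} e^{2\pi i/p}&\rho&-\bar\tau\\0&1&0\\0&0&1\end{pmatrix},\quad R_2=\begin{pmatrix}1&0&0\\-e^{2\pi i/p}\bar\rho&e^{2\pi i/p}&\sigma\\0&0&1\end{pmatrix},\quad R_3=\begin{pmatrix}1&0&0\\0&1&0\\ e^{2\pi i/p}\tau&-e^{2\pi i/p}\bar\sigma&e^{2\pi i/p}\end{pmatrix}.$$ These are complex reflections preserving the Hermitian form $$H=\begin{pmatrix}2\sin(\pi/p)&-ie^{-i\pi/p}\rho&ie^{-i\pi/p}\bar\tau\\ ie^{i\pi/p}\bar\rho&2\sin(\pi/p)&-ie^{-i\pi/p}\sigma\\-ie^{i\pi/p}\tau&ie^{i\pi/p}\bar\sigma&2\sin(\pi/p)\end{pmatrix}.$$ The group $\langle R_1,R_2,R_3\rangle$ is regarded as a subgroup of ${\rm PGL}(3,\mathbb{C})$; in the cases listed below, ${\rm PU}(H)$ is identified with ${\rm PU}(2,1)$ and the group is a lattice in it. **The list of lattices** (the symbol $(a,b,c;d)$ records the braiding parameters: the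 braid lengths of the pairs $(R_2,R_3)$, $(R_3,R_1)$, $(R_1,R_2)$, $(R_1,R_3^{-1}R_2R_3)$ respectively). (1) Family $(n,n,n;m)$, with $\rho=\sigma=\tau$: - $n=3$: $\tau=-e^{-2\pi i/(3m)}$, with: $m=2$, $p\in\{5,6,7,8,9,10,12,18\}$; $m=3$, $p\in\{4,5,6,7,8,9,10,12,18\}$; $m=4$, $p\in\{3,4,5,6,8,12\}$; $m=5$, $p\in\{3,4,5,10\}$; $m=6$, $p\in\{3,4,6\}$; $m=7$, $p\in\{3,7\}$; $m=8$, $p\in\{3,4\}$; $m=9,10,12$, $p=3$. - $(n,m)=(4,3)$: $\tau=(-1-i\sqrt7)/2$, $p\in\{3,4,5,6,8,12\}$. - $(4,4)$: $\tau=e^{i\pi/3}+e^{-i\pi/6}$, $p\in\{3,4,5,6,8,12\}$. - $(4,5)$: $\tau=e^{-i\pi/9}(\sqrt5+i\sqrt3)/2$, $p\in\{2,3,4\}$. - $(5,3)$: $\tau=(1+\sqrt5)/2$, $p\in\{3,4,5,10\}$. - $(5,5)$: $\tau=e^{4\pi i/15}+e^{-2\pi i/15}$, $p\in\{2,3,4,5,10\}$. - $(6,4)$: $\tau=-1+i\sqrt2$, $p\in\{3,4,6\}$. (2) Family $(n,n,m;m)$, with $\sigma=\tau=\sqrt{\rho+\bar\rho}=2\cos(\pi/n)$: - $(n,m)=(3,3)$: $\rho=e^{i\pi/3}$, $p\in\{4,5,6,7,8,9,10,12,18\}$. - $(3,4)$: $\rho=(1+i\sqrt7)/2$, $p\in\{3,4,5,6,8,12\}$.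 - $(3,5)$: $\rho=-e^{-2\pi i/5}-e^{-4\pi i/5}$, $p\in\{2,3,5,10,-5\}$. - $(4,3)$: $\rho=1$, $p\in\{4,5,6,8,12\}$. - $(4,4)$: $\rho=1+i$, $p\in\{3,4,5,6,8,12\}$. - $(5,4)$: $\rho=e^{i\pi/3}(\sqrt5-i\sqrt3)/2$, $p\in\{3,4,5\}$. - $(5,5)$: $\rho=e^{2\pi i/5}+1$, $p\in\{2,3,4,5,10\}$. (3) Family $(3,3,4;n)$, with $\sigma=\tau=1$: - $n=3$: $\rho=1+i$, $p\in\{3,4,5,6,8,12\}$. - $n=4$: $\rho=(1+i\sqrt7)/2$, $p\in\{3,4,5,6,8,12\}$. - $n=5$: $\rho=e^{2\pi i/3}(\sqrt5-i\sqrt3)/2$, $p\in\{3,4,5\}$. - $n=6$: $\rho=i\sqrt2$, $p\in\{3,4,6\}$. - $n=7$: $\rho=e^{6\pi i/7}(-1+i\sqrt7)/2$, $p\in\{2,7\}$. (4) Family $(2,3,n;n)$, with $\sigma=0$, $\tau=1$, $\rho=2\cos(\pi/n)$: - $n=3$: $p\in\{5,6,7,8,9,10,12,18\}$; $n=4$: $p\in\{4,5,6,8,12\}$; $n=5$: $p\in\{3,4,5,10\}$; $n=6$: $p\in\{3,4,6\}$. (5) Family $(3,4,4;4)$, the groups $\mathcal{T}(p,{\bf E}_2)$, with $\rho=\tau=\sqrt2$, $\sigma=e^{i\pi/3}$: $p\in\{3,4,6,12\}$. **Hypergeometric groups.** With $\theta=z\frac{d}{dz}$, the third order hypergeometric equation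 with parameters $\alpha_j,\beta_j\in\mathbb{C}$ is $$\bigl[(\theta+\beta_1-1)(\theta+\beta_2-1)(\theta+\beta_3-1)-z(\theta+\alpha_1)(\theta+\alpha_2)(\theta+\alpha_3)\bigr]w=0 .$$ Put $a_j=e^{2\pi i\alpha_j}$, $b_j=e^{2\pi i\beta_j}$ and assume $a_j\ne b_k$ for all $j,k$. By results of Levelt and Beukers--Heckman, its monodromy group is, up to conjugation in ${\rm GL}(3,\mathbb{C})$, the hypergeometric group $H(a;b)$: the subgroup of ${\rm GL}(3,\mathbb{C})$ generated by $A,B$ with characteristic polynomials $\prod_j(t-a_j)$ and $\prod_j(t-b_j)$ and such that $BA^{-1}-I$ has rank one (the pair $(A,B)$ is unique up to simultaneous conjugation). Monodromy groups are regarded projectively here, i.e. through their images in ${\rm PGL}(3,\mathbb{C})$. **Commensurability.** Two subgroups of ${\rm PGL}(3,\mathbb{C})$ are commensurable if, after conjugating one of them, their intersection has finite index in each. *)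

(* Defs.v *)
From HB Require Import structures.
From mathcomp Require Import all_boot all_order all_algebra.
From mathcomp Require Import generic_quotient.
From mathcomp Require Import all_classical all_reals all_analysis.
From mathcomp Require Import complex.
Set Implicit Arguments.
Unset Strict Implicit.
Unset Printing Implicit Defensive.
Import Order.TTheory GRing.Theory Num.Theory.

(* Subgroups of an arbitrary (possibly infinite) group, as classical sets. *)
Section AbstractGroups.
Variable gT : groupType.
Implicit Types (x g : gT) (S G H : set gT).
Local Open Scope group_scope.
Local Open Scope classical_set_scope.

Definition subgroup G : Prop :=
  [/\ G 1, (forall x y, G x -> G y -> G (x * y)) & (forall x, G x -> G x^-1)].

Definition generated S : set gT := smallest subgroup S.

Definition left_coset x G : set gT := [set x * h | h in G].

Definition finite_index G H : Prop :=
  H `<=` G /\ finite_set [set left_coset x H | x in G].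

Definition conj_subgroup G g : set gT := [set x ^ g | x in G].

Definition commensurable G H : Prop :=
  exists g, let K := conj_subgroup G g `&` H in
    finite_index (conj_subgroup G g) K /\ finite_index H K.

End AbstractGroups.

Section ProjectiveLinearGroup.
Variables (K : fieldType) (n : nat).
Local Open Scope ring_scope.
Local Open Scope quotient_scope.

Record GL := MkGL { GLmx :> 'M[K]_n; GL_unitmx : GLmx \in unitmx }.
HB.instance Definition _ := [isSub for GLmx].
HB.instance Definition _ := [Choice of GL by <:].
Implicit Types A B D : GL.

Fact GLmul_subproof A B : A *m B \in unitmx.
Proof. by rewrite unitmx_mul !GL_unitmx. Qed.
Fact GLone_subproof : (1%:M : 'M[K]_n) \in unitmx.
Proof. exact: unitmx1. Qed.
Fact GLinv_subproof A : invmx A \in unitmx.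
Proof. by rewrite unitmx_inv GL_unitmx. Qed.

Definition GLmul A B : GL := MkGL (GLmul_subproof A B).
Definition GLone : GL := MkGL GLone_subproof.
Definition GLinv A : GL := MkGL (GLinv_subproof A).

Fact GLmulA : associative GLmul.
Proof. by move=> A B D; apply: val_inj; rewrite /= mulmxA. Qed.
Fact GLmul1 : left_id GLone GLmul.
Proof. by move=> A; apply: val_inj; rewrite /= mul1mx. Qed.
Fact GLmulr1 : right_id GLone GLmul.
Proof. by move=> A; apply: val_inj; rewrite /= mulmx1. Qed.
Fact GLmulV : left_inverse GLone GLinv GLmul.
Proof. by move=> A; apply: val_inj; rewrite /= mulVmx ?GL_unitmx. Qed.
Fact GLmulrV : right_inverse GLone GLinv GLmul.
Proof. by move=> A; apply: val_inj; rewrite /= mulmxV ?GL_unitmx. Qed.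

HB.instance Definition _ :=
  isGroup.Build GL GLmulA GLmul1 GLmulr1 GLmulV GLmulrV.

(* A and B are invertible, so the scalar A B^-1 is automatically nonzero. *)
Definition proportional A B : bool := is_scalar_mx (A *m invmx B).

Lemma proportionalP A B :
  reflect (exists2 a : K, a != 0 & GLmx A = a *: GLmx B) (proportional A B).
Proof.
apply: (iffP is_scalar_mxP) => [[a Ea]|[a _ Ea]]; last first.
  by exists a; rewrite Ea -scalemxAl mulmxV ?GL_unitmx // scalemx1.
have EA : GLmx A = a *: GLmx B.
  by rewrite -mul_scalar_mx -Ea mulmxKV ?GL_unitmx.
have [a0|] := eqVneq a 0; last by exists a.
exists 1; rewrite ?oner_neq0 // scale1r.
move: (GL_unitmx A); rewrite EA a0 scale0r => /mulmxV M0.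
rewrite -[RHS]mul1mx -M0 !mul0mx //.
Qed.

Fact proportional_equiv : equiv_class_of proportional.
Proof.
split=> [A|A B|B A D].
- by apply/proportionalP; exists 1; rewrite ?oner_neq0 ?scale1r.
- apply/proportionalP/proportionalP => -[a a0 E]; exists a^-1;
    by rewrite ?invr_neq0 // E scalerA mulVf // scale1r.
- move=> /proportionalP[a a0 Ea] /proportionalP[b b0 Eb].
  by apply/proportionalP; exists (a * b); rewrite ?mulf_neq0 // Ea Eb scalerA.
Qed.

Canonical proportional_equiv_rel := EquivRelPack proportional_equiv.

Definition PGL := {eq_quot proportional}%qT.
HB.instance Definition _ := Choice.on PGL.
HB.instance Definition _ := EqQuotient.on PGL.

Definition toPGL (A : GL) : PGL := \pi_PGL A.

Definition PGLmul (x y : PGL) : PGL := toPGL (GLmul (repr x) (repr y)).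
Definition PGLone : PGL := toPGL GLone.
Definition PGLinv (x : PGL) : PGL := toPGL (GLinv (repr x)).

Lemma toPGL_eq A B : reflect (toPGL A = toPGL B) (proportional A B).
Proof. exact: (eqquotP PGL). Qed.

Lemma proportional_repr A : proportional (repr (toPGL A)) A.
Proof. by apply/toPGL_eq; rewrite /toPGL reprK. Qed.

Lemma toPGL_mul A B : toPGL (GLmul A B) = PGLmul (toPGL A) (toPGL B).
Proof.
apply/esym/toPGL_eq/proportionalP.
have /proportionalP[a a0 Ea] := proportional_repr A.
have /proportionalP[b b0 Eb] := proportional_repr B.
exists (a * b); first exact: mulf_neq0.
by rewrite /= Ea Eb -scalemxAl -scalemxAr scalerA.
Qed.

Lemma toPGL_inv A : toPGL (GLinv A) = PGLinv (toPGL A).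
Proof.
apply/esym/toPGL_eq/proportionalP.
have /proportionalP[a a0 Ea] := proportional_repr A.
by exists a^-1; rewrite ?invr_neq0 //= Ea invmxZ ?unitmxZ ?unitfE ?GL_unitmx.
Qed.

Lemma toPGL_repr (x : PGL) : toPGL (repr x) = x.
Proof. exact: reprK. Qed.

Fact PGLmulA : associative PGLmul.
Proof.
move=> x y z; rewrite -(toPGL_repr x) -(toPGL_repr y) -(toPGL_repr z).
by rewrite -!toPGL_mul GLmulA.
Qed.
Fact PGLmul1 : left_id PGLone PGLmul.
Proof. by move=> x; rewrite -(toPGL_repr x) -toPGL_mul GLmul1. Qed.
Fact PGLmulr1 : right_id PGLone PGLmul.
Proof. by move=> x; rewrite -(toPGL_repr x) -toPGL_mul GLmulr1. Qed.
Fact PGLmulV : left_inverse PGLone PGLinv PGLmul.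
Proof. by move=> x; rewrite -(toPGL_repr x) -toPGL_inv -toPGL_mul GLmulV. Qed.
Fact PGLmulrV : right_inverse PGLone PGLinv PGLmul.
Proof. by move=> x; rewrite -(toPGL_repr x) -toPGL_inv -toPGL_mul GLmulrV. Qed.

HB.instance Definition _ :=
  isGroup.Build PGL PGLmulA PGLmul1 PGLmulr1 PGLmulV PGLmulrV.

End ProjectiveLinearGroup.

Section ComplexExponential.
Variable R : realType.
Local Open Scope ring_scope.
Local Open Scope complex_scope.

(* e^(i x) for real x. *)
Definition expi (x : R) : R[i] := cos x +i* sin x.

Definition cexp (z : R[i]) : R[i] := (expR (complex.Re z))%:C * expi (complex.Im z).

Lemma expi_neq0 (x : R) : expi x != 0.
Proof.
apply/eqP => -[c0 s0]; have := cos2Dsin2 x.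
by rewrite c0 s0 expr0n addr0 => /esym/eqP; rewrite oner_eq0.
Qed.

End ComplexExponential.

Section ReflectionGroups.
Variable R : realType.
Local Open Scope ring_scope.
Local Open Scope complex_scope.
Local Notation C := (R[i]).

Definition mx33 (rows : seq (seq C)) : 'M[C]_3 :=
  \matrix_(i < 3, j < 3) nth 0 (nth [::] rows i) j.

Section Generators.
Variables (p : int) (rho sigma tau : C).

Definition zeta : C := expi (2 * pi / p%:~R).

Definition R1mx : 'M[C]_3 := mx33
  [:: [:: zeta; rho; - tau^*%C];
      [::    0;   1;       0];
      [::    0;   0;       1]].

Definition R2mx : 'M[C]_3 := mx33
  [:: [::              1;    0;     0];
      [:: - zeta * rho^*%C; zeta; sigma];
      [::              0;    0;     1]].

Definition R3mx : 'M[C]_3 := mx33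
  [:: [::          1;                0;    0];
      [::          0;                1;    0];
      [:: zeta * tau; - zeta * sigma^*%C; zeta]].

Fact R1_unit : R1mx \in unitmx.
Proof.
rewrite unitmxE -det_tr det_trig; last first.
  by apply/is_trig_mxP => -[[|[|[|?]]] ?] [[|[|[|?]]] ?] //= _; rewrite !mxE.
by rewrite !big_ord_recl big_ord0 !mxE /= !mulr1 unitfE expi_neq0.
Qed.

Fact R2_unit : R2mx \in unitmx.
Proof.
rewrite unitmxE (expand_det_row _ ord0) !big_ord_recl big_ord0 [X in X * _]mxE.
rewrite /= mul1r !mxE /= !mul0r !addr0 /cofactor /= expr0 mul1r.
rewrite (expand_det_row _ ord_max) !big_ord_recl big_ord0 !mxE /= mul0r mul1r.
by rewrite add0r addr0 /cofactor det_mx11 !mxE /= expr2 mulrN1 opprK mul1r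
  unitfE expi_neq0.
Qed.

Fact R3_unit : R3mx \in unitmx.
Proof.
rewrite unitmxE det_trig; last first.
  by apply/is_trig_mxP => -[[|[|[|?]]] ?] [[|[|[|?]]] ?] //= _; rewrite !mxE.
by rewrite !big_ord_recl big_ord0 !mxE /= !mul1r mulr1 unitfE expi_neq0.
Qed.

Definition R1 : GL C 3 := MkGL R1_unit.
Definition R2 : GL C 3 := MkGL R2_unit.
Definition R3 : GL C 3 := MkGL R3_unit.

Definition reflection_group : set (PGL C 3) :=
  generated [set toPGL R1; toPGL R2; toPGL R3]%classic.

End Generators.

(* ((a, b), c, d) stands for the symbol (a,b,c;d). *)
Definition braiding : Type := (nat * nat * nat * nat)%type.

(* Rows (n, m, admissible p, tau) of the family (n,n,n;m). *)
Variant family_nnnm : nat -> nat -> seq int -> C -> Prop :=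
| Nnnm_3 (m : nat) (ps : seq int) of
    (m, ps) \in
      [:: ( 2%N, [:: 5; 6; 7; 8; 9; 10; 12; 18] : seq int);
          ( 3%N, [:: 4; 5; 6; 7; 8; 9; 10; 12; 18]);
          ( 4%N, [:: 3; 4; 5; 6; 8; 12]);
          ( 5%N, [:: 3; 4; 5; 10]);
          ( 6%N, [:: 3; 4; 6]);
          ( 7%N, [:: 3; 7]);
          ( 8%N, [:: 3; 4]);
          ( 9%N, [:: 3]);
          (10%N, [:: 3]);
          (12%N, [:: 3])] :
    family_nnnm 3 m ps (- expi (- (2 * pi / (3 * m%:R))))
| Nnnm_43 : family_nnnm 4 3 [:: 3; 4; 5; 6; 8; 12]
    ((- 1 - 'i%C * (Num.sqrt 7)%:C) / 2)
| Nnnm_44 : family_nnnm 4 4 [:: 3; 4; 5; 6; 8; 12]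
    (expi (pi / 3) + expi (- (pi / 6)))
| Nnnm_45 : family_nnnm 4 5 [:: 2; 3; 4]
    (expi (- (pi / 9)) * ((Num.sqrt 5)%:C + 'i%C * (Num.sqrt 3)%:C) / 2)
| Nnnm_53 : family_nnnm 5 3 [:: 3; 4; 5; 10]
    ((1 + (Num.sqrt 5)%:C) / 2)
| Nnnm_55 : family_nnnm 5 5 [:: 2; 3; 4; 5; 10]
    (expi (4 * pi / 15) + expi (- (2 * pi / 15)))
| Nnnm_64 : family_nnnm 6 4 [:: 3; 4; 6]
    (- 1 + 'i%C * (Num.sqrt 2)%:C).

(* Rows (n, m, admissible p, rho) of the family (n,n,m;m). *)
Variant family_nnmm : nat -> nat -> seq int -> C -> Prop :=
| Nnmm_33 : family_nnmm 3 3 [:: 4; 5; 6; 7; 8; 9; 10; 12; 18]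
    (expi (pi / 3))
| Nnmm_34 : family_nnmm 3 4 [:: 3; 4; 5; 6; 8; 12]
    ((1 + 'i%C * (Num.sqrt 7)%:C) / 2)
| Nnmm_35 : family_nnmm 3 5 [:: 2; 3; 5; 10; - 5]
    (- expi (- (2 * pi / 5)) - expi (- (4 * pi / 5)))
| Nnmm_43 : family_nnmm 4 3 [:: 4; 5; 6; 8; 12]
    1
| Nnmm_44 : family_nnmm 4 4 [:: 3; 4; 5; 6; 8; 12]
    (1 + 'i%C)
| Nnmm_54 : family_nnmm 5 4 [:: 3; 4; 5]
    (expi (pi / 3) * ((Num.sqrt 5)%:C - 'i%C * (Num.sqrt 3)%:C) / 2)
| Nnmm_55 : family_nnmm 5 5 [:: 2; 3; 4; 5; 10]
    (expi (2 * pi / 5) + 1).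

(* Rows (n, admissible p, rho) of the family (3,3,4;n). *)
Variant family_334n : nat -> seq int -> C -> Prop :=
| N334_3 : family_334n 3 [:: 3; 4; 5; 6; 8; 12]
    (1 + 'i%C)
| N334_4 : family_334n 4 [:: 3; 4; 5; 6; 8; 12]
    ((1 + 'i%C * (Num.sqrt 7)%:C) / 2)
| N334_5 : family_334n 5 [:: 3; 4; 5]
    (expi (2 * pi / 3) * ((Num.sqrt 5)%:C - 'i%C * (Num.sqrt 3)%:C) / 2)
| N334_6 : family_334n 6 [:: 3; 4; 6]
    ('i%C * (Num.sqrt 2)%:C)
| N334_7 : family_334n 7 [:: 2; 7]
    (expi (6 * pi / 7) * (- 1 + 'i%C * (Num.sqrt 7)%:C) / 2).

(* For every row of the family (n,n,m;m), sqrt (rho + rho^*%C ) = twocos n. *)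
Definition twocos (n : nat) : C := (2 * cos (pi / n%:R))%:C.

(* [DPP_lattice s p rho sigma tau]: the group <R1, R2, R3> with parameters
   p, rho, sigma, tau and braiding symbol s is in the list of
   Deraux-Parker-Paupert lattices. *)
Variant DPP_lattice : braiding -> int -> C -> C -> C -> Prop :=
| DPP_nnnm n m ps tau p of family_nnnm n m ps tau & p \in ps :
    DPP_lattice (n, n, n, m) p tau tau tau
| DPP_nnmm n m ps rho p of family_nnmm n m ps rho & p \in ps :
    DPP_lattice (n, n, m, m) p rho (twocos n) (twocos n)
| DPP_334n n ps rho p of family_334n n ps rho & p \in ps :
    DPP_lattice (3, 3, 4, n)%N p rho 1 1
| DPP_23nn n ps p of
    (n, ps) \in
      [:: (3%N, [:: 5; 6; 7; 8; 9; 10; 12; 18] : seq int);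
          (4%N, [:: 4; 5; 6; 8; 12]);
          (5%N, [:: 3; 4; 5; 10]);
          (6%N, [:: 3; 4; 6])] & p \in ps :
    DPP_lattice (2, 3, n, n)%N p (twocos n) 0 1
| DPP_E2 p of p \in ([:: 3; 4; 6; 12] : seq int) :
    DPP_lattice (3, 4, 4, 4)%N p
      (Num.sqrt 2)%:C (expi (pi / 3)) (Num.sqrt 2)%:C.

(* The only groups in the list with symbol (3,4,4;4) are the T(p,E_2). *)
Definition excluded (s : braiding) (p : int) : Prop :=
  s = (3, 4, 4, 4)%N /\ p \in ([:: 3; 6; 12] : seq int).

End ReflectionGroups.

Section HypergeometricGroups.
Variable R : realType.
Local Open Scope ring_scope.
Local Open Scope complex_scope.
Local Notation C := (R[i]).

Definition expi2pi (alpha : C) : C := cexp (2 * pi%:C * 'i%C * alpha).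

(* A pair generating the hypergeometric group H(a;b). *)
Definition hypergeometric_pair (a b : 'I_3 -> C) (A B : GL C 3) : Prop :=
  [/\ char_poly A = \prod_(j < 3) ('X - (a j)%:P),
      char_poly B = \prod_(j < 3) ('X - (b j)%:P) &
      \rank ((B : 'M[C]_3) *m invmx A - 1%:M) = 1%N].

(* G is the projective monodromy group of the third order hypergeometric
   equation
     [(t + beta_1 - 1)(t + beta_2 - 1)(t + beta_3 - 1)
        - z (t + alpha_1)(t + alpha_2)(t + alpha_3)] w = 0,   t = z d/dz,
   where a_j <> b_k for all j, k. A monodromy group depends on a base point
   and on a basis of local solutions, hence is only defined up to conjugation
   in GL(3,C); by Levelt and Beukers-Heckman its conjugates are the
   hypergeometric groups H(a;b) with a_j = e^(2 pi i alpha_j) and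
   b_j = e^(2 pi i beta_j). *)
Definition hypergeometric_monodromy (alpha beta : 'I_3 -> C)
    (G : set (PGL C 3)) : Prop :=
  let a j := expi2pi (alpha j) in
  let b j := expi2pi (beta j) in
  (forall j k, a j != b k) /\
  exists A B : GL C 3, hypergeometric_pair a b A B /\
    G = generated [set toPGL A; toPGL B]%classic.

End HypergeometricGroups.

(* Main.v *)
Require Import Defs.
From mathcomp Require Import all_boot all_order all_algebra.
From mathcomp Require Import all_classical all_reals all_analysis.
From mathcomp Require Import complex.
From mathcomp Require Import ring lra.

(** Let G = <R1, R2, R3>, and write R_i = 1 + e_i phi_i, with e_i the standard
    basis vectors and phi_i a row.  A hypergeometric group is a group generated
    by a matrix A and r A with r - 1 of rank one, such that A and r A have no
    common eigenvalue.  So it suffices to find one of the reflections r and a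
    matrix A such that M = <A, r A> contains G with finite index.  In each
    family some r = R_i works, and G is normal in M with cyclic quotient of
    order at most 3:

    - rho = sigma = tau: a monomial matrix J of projective order 3 permutes
      R1, R2, R3 cyclically; M = <J, R1 J>.

    - sigma = tau = a real with a^2 = rho + rho^*: there is a square root Q of
      R3 with Q R1 Q^-1 = R2 (then Q R2 Q^-1 = R3 R1 R3^-1); M = <Q, R1 Q>.

    - sigma = tau = 1 and |rho|^2 = 2: for A = R2 R1 R3 the braid relations give
      A^2 R1 A^-2 = R1^-1 R2 R1, hence <A, R1 A> = G.

    - sigma = 0, tau = 1 and rho real: for c = R3 R1 R2 one has c R3 c^-1 = R1,
      hence <R1 R2, c> = G.

    - T(p, E_2): there is a complex reflection g of projective order 3 that
      commutes with R1 and satisfies g R2 g^-1 = R3 and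
      g R3 g^-1 = R3^-1 R2 R3.  For p = 4 the orders 3 and 4 of g and R1 are
      coprime, so the single element A = g R1 generates both of them and
      M = <A, R2 A> contains R1, R2 and R3 = g R2 g^-1.  This is where p = 3,
      6, 12 drop out.

    The finite index statements are finite_index_cyclic_extension and
    commensurable_finite_index; the matrix identities behind the list above are
    checked entry by entry in the lemmas whose names end with companion.

    By Levelt's argument (no_common_eigenvalue), A and r A = (1 + e phi) A have
    no common eigenvalue as soon as e, A e, A^2 e and phi, phi A, phi A^2 are
    bases.  For T(4, E_2) the two determinants are explicit numbers.  In the first
    four families the first one is visibly nonzero, and the second one is a
    nonzero multiple of det (phi_1; phi_2; phi_3), hence of the determinant of
    the Hermitian form H.  With t = pi / p,
    S = |rho|^2 + |sigma|^2 + |tau|^2 and rho sigma tau = X + i Y, it vanishes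
    iff sin t (S - X - 4 sin^2 t) + cos t Y = 0 (mirror_det_neq0).  Nearly all
    rows of the list have Y >= 0 and p > 0, and then both terms are nonnegative,
    with one of them positive, as soon as this holds for the smallest p of the
    row.  The exceptions are p = -5 and the row (3,3,4;7), which are settled
    by the minimal polynomials of cos (pi / 5) and cos (pi / 7). *)

Set Implicit Arguments.
Unset Strict Implicit.
Unset Printing Implicit Defensive.
Import Order.TTheory GRing.Theory Num.Theory.

(** * Subgroups of finite index *)

Section FiniteIndex.
Variable gT : groupType.
Implicit Types (x y z : gT) (S T G H : set gT).
Local Open Scope group_scope.
Local Open Scope classical_set_scope.

Lemma subgroup1 G : subgroup G -> G 1. Proof. by case. Qed.

Lemma subgroupM G x y : subgroup G -> G x -> G y -> G (x * y).
Proof. by case=> _ + _; apply. Qed.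

Lemma subgroupV G x : subgroup G -> G x -> G x^-1.
Proof. by case=> _ _; apply. Qed.

Lemma subgroupX G x n : subgroup G -> G x -> G (x ^+ n).
Proof.
move=> sG Gx; elim: n => [|n IHn]; first by rewrite expg0; exact: subgroup1.
by rewrite expgS; exact: subgroupM.
Qed.

Lemma sub_generated S : S `<=` generated S.
Proof. by move=> x Sx G [_]; apply. Qed.

Lemma generated_sub S G : subgroup G -> S `<=` G -> generated S `<=` G.
Proof. by move=> sG SG x; apply; split. Qed.

Lemma subgroup_generated S : subgroup (generated S).
Proof.
split=> [G [sG _]|x y Sx Sy G [sG SG]|x Sx G [sG SG]].
- exact: subgroup1.
- by apply: subgroupM => //;
    [exact: (Sx G (conj sG SG)) | exact: (Sy G (conj sG SG))].
- by apply: subgroupV => //; exact: (Sx G (conj sG SG)).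
Qed.

Lemma commensurable_finite_index G H : subgroup G -> finite_index H G ->
  commensurable G H.
Proof.
move=> sG HG; have [GH _] := HG; exists 1.
have -> : conj_subgroup G 1 = G.
  by apply/seteqP; split=> [_ [x Gx <-]|x Gx]; [|exists x]; rewrite ?conjg1.
rewrite (setIidl GH); split=> //; split=> //.
apply: (@sub_finite_set _ _ [set G]); last exact: finite_set1.
move=> _ [x Gx <-] /=; apply/seteqP; split=> [_ [y Gy <-]|y Gy].
  exact: subgroupM.
exists (x^-1 * y); last exact: mulVKg.
exact: (subgroupM sG (subgroupV sG Gx) Gy).
Qed.

(** An element x that conjugates the generators S into <S>, with a positive power
    in <S>, normalizes <S>: its inverse is a positive power of x times an element
    of <S>.  So the cosets x^k <S> form a group. *)
Section CyclicExtension.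
Variables (S : set gT) (x : gT) (n : nat).
Hypothesis nSx : forall y, S y -> generated S (x * y * x^-1).
Hypothesis Sxn : generated S (x ^+ n.+1).
Let G := generated S.
Let sG : subgroup G := subgroup_generated S.

Let GJ y : G y -> G (x * y * x^-1).
Proof.
pose N := [set y | G (x * y * x^-1)].
suff : G `<=` N by apply.
apply: generated_sub => //; split; rewrite /N /=.
- by rewrite mulg1 mulgV; apply: subgroup1.
- move=> y1 y2 Gy1 Gy2; have := subgroupM sG Gy1 Gy2.
  by rewrite !mulgA mulgVK.
- by move=> y1 Gy1; have := subgroupV sG Gy1; rewrite !invgM invgK mulgA.
Qed.

Let GJX k y : G y -> G (x ^+ k * y * x ^- k).
Proof.
elim: k y => [|k IHk] y Gy; first by rewrite expg0 mul1g invg1 mulg1.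
by have := GJ (IHk y Gy); rewrite expgS invgM !mulgA.
Qed.

(* x^-1 = x^n x^-(n+1), and x^(n+1) lies in G. *)
Let GJV y : G y -> G (x^-1 * y * x).
Proof.
move=> Gy.
have := GJX n (subgroupM sG (subgroupM sG (subgroupV sG Sxn) Gy) Sxn).
by rewrite expgS invgM !mulgA mulgV mul1g mulgK.
Qed.

Let GJXV k y : G y -> G (x ^- k * y * x ^+ k).
Proof.
elim: k y => [|k IHk] y Gy; first by rewrite expg0 invg1 mul1g mulg1.
by have := GJV (IHk y Gy); rewrite expgSr invgM !mulgA.
Qed.

Let U : set gT := [set y | exists k, G (x ^- k * y)].

Let sU : subgroup U.
Proof.
split.
- by exists 0%N; rewrite expg0 invg1 mulg1; apply: subgroup1.
- move=> y z [k Gy] [l Gz]; exists (k + l)%N.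
  have := subgroupM sG (GJXV l Gy) Gz.
  by rewrite -!mulgA mulVKg expgnDr invgM !mulgA.
- (* x^-k = x^(k n) x^-(k (n+1)), and the last factor lies in G. *)
  move=> y [k Gy]; exists (k * n)%N.
  have Gk : G (x ^- (k * n.+1)).
    by rewrite mulnC expgnA -expVgn; exact: subgroupX sG (subgroupV sG Sxn).
  have := subgroupM sG (GJXV (k * n) (subgroupV sG Gy)) Gk.
  by rewrite mulnS expgnDr !invgM invgK !mulgA mulgK mulgK.
Qed.

(** If T lies in the union of the cosets x^k <S>, so does <T>; there are at most
    n + 1 such cosets because x^(n+1) is in <S>. *)
Lemma finite_index_cyclic_extension T :
  (forall y, T y -> exists k, generated S (x ^- k * y)) ->
  S `<=` generated T -> finite_index (generated T) (generated S).
Proof.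
move=> TU ST; have sT := subgroup_generated T.
split; first exact: generated_sub.
pose C (k : nat) := left_coset (x ^+ k) G.
apply: (@sub_finite_set _ _ (C @` `I_n.+1)); last first.
  exact/finite_image/finite_II.
move=> _ [h Th <-].
have [k Gk] : U h by apply: (generated_sub sU _ Th) => y /TU.
exists (k %% n.+1)%N => /=; first exact: ltn_pmod.
have Gr : G (x ^- (k %% n.+1) * h).
  have -> : x ^- (k %% n.+1) * h = (x ^+ n.+1) ^+ (k %/ n.+1) * (x ^- k * h).
    have -> : x ^+ k = x ^+ (k %% n.+1) * x ^+ n.+1 ^+ (k %/ n.+1).
      by rewrite -expgnA -expgnDr mulnC addnC -divn_eq.
    by rewrite invgM !mulgA mulgV mul1g.
  exact: (subgroupM sG (subgroupX _ sG Sxn) Gk).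
apply/seteqP; split=> _ [y Gy <-].
  exists ((x ^- (k %% n.+1) * h)^-1 * y).
    exact: (subgroupM sG (subgroupV sG Gr) Gy).
  by rewrite invgM invgK !mulgA mulgV mul1g.
exists (x ^- (k %% n.+1) * h * y); first exact: (subgroupM sG Gr Gy).
by rewrite !mulgA mulgV mul1g.
Qed.

End CyclicExtension.
End FiniteIndex.

(** * Hypergeometric groups from a reflection *)

Section Monodromy.
Variable R : realType.
Local Open Scope ring_scope.
Local Open Scope complex_scope.
Local Notation C := R[i].

Lemma expi_surj (u : C) : complex.Re u ^+ 2 + complex.Im u ^+ 2 = 1 ->
  exists t : R, expi t = u.
Proof.
case: u => c s /= cs1.
have c1 : -1 <= c <= 1.
  rewrite -ler_norml -(@ler_sqr _ _ 1) ?nnegrE ?ler01 //.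
  by rewrite real_normK ?num_real // expr1n -cs1 lerDl sqr_ge0.
have cc : cos (acos c) = c by rewrite acosK // in_itv.
have ss : sin (acos c) = `|s| by rewrite sin_acos // -cs1 addrC addKr sqrtr_sqr.
have [s0|s0] := leP 0 s.
  by exists (acos c); rewrite /expi cc ss ger0_norm.
by exists (- acos c); rewrite /expi cosN sinN cc ss ltr0_norm // opprK.
Qed.

Lemma expi2pi_surj (z : C) : z != 0 -> exists alpha, expi2pi alpha = z.
Proof.
move=> z0; set m := Num.sqrt (complex.Re z ^+ 2 + complex.Im z ^+ 2).
have m2 : m ^+ 2 = complex.Re z ^+ 2 + complex.Im z ^+ 2.
  by rewrite sqr_sqrtr // addr_ge0 ?sqr_ge0.
have m0 : 0 < m.
  rewrite lt_def sqrtr_ge0 andbT -sqrf_eq0 m2.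
  apply: contra z0; rewrite paddr_eq0 ?sqr_ge0 // !sqrf_eq0.
  by case: (z) => x y /= /andP[/eqP-> /eqP->].
have [|t Et] := @expi_surj (z / m%:C).
  have mR0 := lt0r_neq0 m0.
  have -> : z / m%:C = (complex.Re z / m) +i* (complex.Im z / m).
    apply: (mulIf (_ : m%:C != 0)); first by rewrite eq_complex /= (negbTE mR0).
    rewrite divfK ?eq_complex /= ?(negbTE mR0) //.
    by case: (z) => x y /=; simpc; rewrite !divfK.
  by rewrite /= !expr_div_n -mulrDl -m2 divff ?expf_neq0.
pose P : C := 2 * pi%:C * 'i%C.
have P0 : P != 0.
  rewrite /P !mulf_eq0 !negb_or pnatr_eq0 /= !eq_complex /= oner_eq0 andbF.
  by rewrite gt_eqF ?pi_gt0.
exists ((ln m +i* t) / P); rewrite /expi2pi -/P mulrC divfK // /cexp /=.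
by rewrite lnK ?posrE // Et mulrC divfK // eq_complex /= gt_eqF.
Qed.

(** Every eigenvalue of an invertible complex matrix is of the form
    exp (2 pi i alpha), so A may serve as a generator of a hypergeometric group
    whatever its spectrum. *)
Lemma char_poly_splits (A : GL C 3) :
  exists alpha : 'I_3 -> C,
    char_poly A = \prod_(j < 3) ('X - (expi2pi (alpha j))%:P).
Proof.
have [rs Ers] := closed_field_poly_normal (char_poly A).
rewrite (monicP (char_poly_monic A)) scale1r in Ers.
have sz : size rs = 3%N.
  by have := size_char_poly A; rewrite Ers size_prod_XsubC => -[].
have rs0 (j : 'I_3) : exists a, expi2pi a = rs`_j.
  apply: expi2pi_surj; apply/eqP => r0; have := Defs.GL_unitmx A.
  suff : root (char_poly A) 0.
    rewrite rootE horner_coef0 char_poly_det mulf_eq0 signr_eq0 /= => /eqP dA.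
    by rewrite unitmxE dA unitr0.
  by rewrite Ers root_prod_XsubC -r0; apply: mem_nth; rewrite sz.
have [alpha Ealpha] := choice rs0.
exists alpha; rewrite Ers (big_nth 0) sz big_mkord.
by apply: eq_bigr => j _; rewrite Ealpha.
Qed.

(** Suppose that w B = a w and A v = a v.  Evaluating w B v in two ways gives
    a (w e) (f v) = 0, and a != 0 because A is invertible.  If f v = 0, then v
    is killed by all f A^k; if w e = 0, then w is also an eigenvector of A and is
    orthogonal to all A^k e.  Either way, cyclicity of f or of e is
    contradicted. *)
Lemma no_common_eigenvalue (F : fieldType) n (A B : 'M[F]_n.+1) (e : 'cV_n.+1)
    (f : 'rV_n.+1) a :
  A \in unitmx -> B = (1%:M + e *m f) *m A ->
  (forall w : 'rV_n.+1, (forall k, w *m (A ^+ k) *m e = 0) -> w = 0) ->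
  (forall v : 'cV_n.+1, (forall k, f *m (A ^+ k) *m v = 0) -> v = 0) ->
  ~~ (root (char_poly A) a && root (char_poly B) a).
Proof.
move=> uA EB cyce cycf; apply/negP => /andP[Aa].
rewrite -eigenvalue_root_char => /eigenvalueP[w wB /negP[]].
have [v v0 Av] : exists2 v : 'cV_n.+1, v != 0 & A *m v = a *: v.
  have : \det (A - a%:M)^T == 0.
    rewrite det_tr; move: Aa; rewrite -eigenvalue_root_char.
    rewrite /eigenvalue /eigenspace kermx_eq0 row_free_unit unitmxE unitfE.
    by rewrite negbK.
  case/det0P => u u0 Eu; exists u^T; first by rewrite trmx_eq0.
  move/(congr1 trmx): Eu; rewrite trmx_mul trmxK trmx0 mulmxBl mul_scalar_mx.
  by move/eqP; rewrite subr_eq0 => /eqP.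
have AXv k : A ^+ k *m v = a ^+ k *: v.
  elim: k => [|k IHk]; first by rewrite expr0 mul1mx scale1r.
  by rewrite exprSr -mulmxE -mulmxA Av -scalemxAr IHk scalerA exprS.
have a0 : a != 0.
  apply: contraNneq v0 => a0; move: Av; rewrite a0 scale0r => Av.
  by rewrite -(mulKmx uA v) Av mulmx0.
have we : w *m e = 0.
  have /eqP := congr1 (mulmx^~ v) wB.
  rewrite EB mulmxA mulmxDr mulmx1 mulmxA -mulmxA Av mulmxDl -scalemxAl.
  rewrite -!scalemxAr -subr_eq0 [X in X - _]addrC addrK scaler_eq0 (negbTE a0).
  rewrite /= (mx11_scalar (w *m e)) mul_scalar_mx -scalemxAl scaler_eq0.
  case/orP => [/eqP->|/eqP fv]; first by rewrite raddf0.
  case/eqP: v0; apply: cycf => k.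
  by rewrite -mulmxA AXv -scalemxAr fv scaler0.
have wA : w *m A = a *: w.
  by move: wB; rewrite EB mulmxA mulmxDr mulmx1 mulmxA we mul0mx addr0.
apply/eqP/cyce => k; elim: k => [|k]; first by rewrite expr0 mulmx1.
by rewrite exprS -mulmxE mulmxA wA -!scalemxAl => ->; rewrite scaler0.
Qed.

Local Notation i0 := (@Ordinal 3 0 isT).
Local Notation i1 := (@Ordinal 3 1 isT).
Local Notation i2 := (@Ordinal 3 2 isT).

Lemma ord3P (P : 'I_3 -> Prop) : P i0 -> P i1 -> P i2 -> forall i, P i.
Proof.
move=> P0 P1 P2 [[|[|[|//]]] lti]; [move: P0|move: P1|move: P2];
  by congr P; apply: val_inj.
Qed.

(** krylov_cols A E says that E = (e | A e | A^2 e) for some column e, and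
    krylov_rows A F that F = (f; f A; f A^2) for some row f.  Only equations
    between entries are involved, so concrete instances reduce to ring
    identities. *)
Definition krylov_cols (A E : 'M[C]_3) : Prop :=
  forall i, (A *m E) i i0 = E i i1 /\ (A *m E) i i1 = E i i2.

Definition krylov_rows (A F : 'M[C]_3) : Prop :=
  forall j, (F *m A) i0 j = F i1 j /\ (F *m A) i1 j = F i2 j.

(** The reflection r is 1 + e f, with e and f the first column of E and the first
    row of F; invertibility of E and F is the cyclicity of e and f. *)
Lemma hypergeometric_of_reflection (A r : GL C 3) (E F : 'M[C]_3) :
  (forall i j, GLmx r i j = (i == j)%:R + E i i0 * F i0 j) ->
  krylov_cols A E -> krylov_rows A F -> \det E != 0 -> \det F != 0 ->
  exists alpha beta,
    hypergeometric_monodromy alpha beta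
      (generated [set toPGL A; toPGL (GLmul r A)]%classic).
Proof.
move=> Er EA FA dE dF.
have uE : E \in unitmx by rewrite unitmxE unitfE.
have uF : F \in unitmx by rewrite unitmxE unitfE.
have ErM : GLmx r = 1%:M + col i0 E *m row i0 F.
  by apply/matrixP => i j; rewrite Er !mxE big_ord1 !mxE.
have AE0 : A *m col i0 E = col i1 E.
  by apply/colP => i; have [] := EA i; rewrite !mxE => <- _;
    apply: eq_bigr => k _; rewrite mxE.
have AE1 : A *m col i1 E = col i2 E.
  by apply/colP => i; have [] := EA i; rewrite !mxE => _ <-;
    apply: eq_bigr => k _; rewrite mxE.
have FA0 : row i0 F *m A = row i1 F.
  by apply/rowP => j; have [] := FA j; rewrite !mxE => <- _;
    apply: eq_bigr => k _; rewrite mxE.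
have FA1 : row i1 F *m A = row i2 F.
  by apply/rowP => j; have [] := FA j; rewrite !mxE => _ <-;
    apply: eq_bigr => k _; rewrite mxE.
have [alpha Ea] := char_poly_splits A.
have [beta Eb] := char_poly_splits (GLmul r A).
exists alpha, beta; split; last exists A, (GLmul r A).
  move=> j k; apply/eqP => Eab.
  have EB : GLmx (GLmul r A) = (1%:M + col i0 E *m row i0 F) *m A.
    by rewrite -ErM.
  have := no_common_eigenvalue (expi2pi (alpha j)) (Defs.GL_unitmx A) EB.
  have rootj (c : 'I_3 -> C) l : root (\prod_(j < 3) ('X - (c j)%:P)) (c l).
    by rewrite (bigD1 l) //= rootM root_XsubC eqxx.
  rewrite Ea Eb {2}Eab !rootj => /(_ _ _)/negP; apply=> //.
  - move=> w cw; rewrite -[w](mulmxK uE).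
    suff -> : w *m E = 0 by rewrite mul0mx.
    have wE i : (w *m E) 0 i = (w *m col i E) 0 0.
      by rewrite !mxE; apply: eq_bigr => k' _; rewrite mxE.
    apply/rowP; apply: ord3P; rewrite wE [RHS]mxE.
    + by have := cw 0%N; rewrite expr0 mulmx1 => ->; rewrite mxE.
    + by have := cw 1%N; rewrite expr1 -mulmxA AE0 => ->; rewrite mxE.
    + have := cw 2%N; rewrite expr2 -mulmxE -!mulmxA AE0 AE1 => ->.
      by rewrite mxE.
  - move=> v cv; rewrite -[v](mulKmx uF).
    suff -> : F *m v = 0 by rewrite mulmx0.
    have Fv i : (F *m v) i 0 = (row i F *m v) 0 0.
      by rewrite !mxE; apply: eq_bigr => k' _; rewrite mxE.
    apply/colP; apply: ord3P; rewrite Fv [RHS]mxE.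
    + by have := cv 0%N; rewrite expr0 mulmx1 => ->; rewrite mxE.
    + by have := cv 1%N; rewrite expr1 FA0 => ->; rewrite mxE.
    + have := cv 2%N; rewrite expr2 -mulmxE mulmxA FA0 FA1 => ->.
      by rewrite mxE.
split=> //; split=> //.
rewrite /= mulmxK ?Defs.GL_unitmx // ErM addrC addKr colE rowE.
rewrite -mulmxA (mulmxA (delta_mx _ _)) mul_delta_mx.
rewrite (eqmxMfull _ _) ?row_full_unit // mxrankMfree ?row_free_unit //.
exact: mxrank_delta.
Qed.
End Monodromy.

(** * Explicit matrices and their classes in PGL(3) *)

Section Criterion.
Variable R : realType.
Local Open Scope ring_scope.
Local Open Scope complex_scope.
Local Notation C := R[i].
Local Notation M3 a b c d e f g h i :=
  (mx33 [:: [:: a; b; c]; [:: d; e; f]; [:: g; h; i]]).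

Lemma mx33_eq (a b c d e f g h i a' b' c' d' e' f' g' h' i' : C) :
  a = a' -> b = b' -> c = c' -> d = d' -> e = e' -> f = f' ->
  g = g' -> h = h' -> i = i' ->
  M3 a b c d e f g h i = M3 a' b' c' d' e' f' g' h' i'.
Proof. by move=> -> -> -> -> -> -> -> -> ->. Qed.

Lemma mulmx_mx33 (a b c d e f g h i a' b' c' d' e' f' g' h' i' : C) :
  M3 a b c d e f g h i *m M3 a' b' c' d' e' f' g' h' i' =
  M3 (a * a' + b * d' + c * g') (a * b' + b * e' + c * h')
     (a * c' + b * f' + c * i')
     (d * a' + e * d' + f * g') (d * b' + e * e' + f * h')
     (d * c' + e * f' + f * i')
     (g * a' + h * d' + i * g') (g * b' + h * e' + i * h')
     (g * c' + h * f' + i * i').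
Proof.
by apply/matrixP; apply: ord3P; apply: ord3P;
  rewrite !mxE !big_ord_recl big_ord0 !mxE /= addr0 addrA.
Qed.

Lemma scale_mx33 k (a b c d e f g h i : C) :
  k *: M3 a b c d e f g h i =
  M3 (k * a) (k * b) (k * c) (k * d) (k * e) (k * f) (k * g) (k * h) (k * i).
Proof. by apply/matrixP; apply: ord3P; apply: ord3P; rewrite !mxE. Qed.

Lemma det_mx33 (a b c d e f g h i : C) :
  \det (M3 a b c d e f g h i) =
  a * (e * i - f * h) - b * (d * i - f * g) + c * (d * h - e * g).
Proof.
have det2 (M : 'M[C]_2) :
    \det M = M ord0 ord0 * M ord_max ord_max - M ord0 ord_max * M ord_max ord0.
  rewrite (expand_det_row _ ord0) !big_ord_recl big_ord0 /cofactor !det_mx11.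
  rewrite !mxE /= expr0 expr1 mul1r mulN1r mulrN addr0.
  by congr (_ * M _ _ - M _ _ * M _ _); apply: val_inj.
rewrite (expand_det_row _ ord0) !big_ord_recl big_ord0 !mxE /=.
rewrite /cofactor !det2 !mxE /=.
ring.
Qed.

Lemma toPGL_scaled (A B : GL C 3) k :
  k != 0 -> GLmx A = k *: GLmx B -> toPGL A = toPGL B.
Proof. by move=> k0 AB; apply/toPGL_eq/proportionalP; exists k. Qed.

Lemma toPGL_eq_mx (A B : GL C 3) : GLmx A = GLmx B -> toPGL A = toPGL B.
Proof. by move=> AB; congr toPGL; exact: val_inj. Qed.

Lemma toPGL_scalar (A : GL C 3) k :
  k != 0 -> GLmx A = M3 k 0 0 0 k 0 0 0 k -> toPGL A = 1%g.
Proof.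
move=> k0 EA; apply: (@toPGL_scaled A (GLone _ _) k) => //; rewrite EA.
by apply/matrixP; apply: ord3P; apply: ord3P; rewrite !mxE ?mulr1 ?mulr0.
Qed.

Lemma toPGLM (A B : GL C 3) : toPGL (GLmul A B) = (toPGL A * toPGL B)%g.
Proof. exact: toPGL_mul. Qed.

Lemma zeta_neq0 p : zeta R p != 0.
Proof. exact: expi_neq0. Qed.

Lemma GL_of_det (A : 'M[C]_3) : \det A != 0 -> exists B : GL C 3, GLmx B = A.
Proof. by rewrite -unitfE -unitmxE => uA; exists (MkGL uA). Qed.

(** The determinant of the matrix whose i-th row is the i-th row of R_i - 1, for
    z = exp (2 pi i / p).  It vanishes iff the three mirrors have a common point
    in the projective plane. *)
Definition mirror_det (z rho sigma tau : C) : C :=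
  (z - 1) ^+ 3 + z * (rho * sigma * tau)
  - z ^+ 2 * (rho^*%C * sigma^*%C * tau^*%C)
  + z * (z - 1) * (rho * rho^*%C + sigma * sigma^*%C + tau * tau^*%C).

End Criterion.

(** * A finite extension of each family by one element *)

Section Families.
Variable R : realType.
Local Open Scope ring_scope.
Local Open Scope complex_scope.
Local Notation C := R[i].
Local Notation M3 a b c d e f g h i :=
  (mx33 [:: [:: a; b; c]; [:: d; e; f]; [:: g; h; i]]).
Local Notation i0 := (@Ordinal 3 0 isT).
Local Notation i1 := (@Ordinal 3 1 isT).
Local Notation i2 := (@Ordinal 3 2 isT).

Definition has_hypergeometric_companion (G : set (PGL C 3)) : Prop :=
  exists (alpha beta : 'I_3 -> C) (M : set (PGL C 3)),
    hypergeometric_monodromy alpha beta M /\ commensurable G M.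

Section Params.
Variables (p : int).
Let z : C := zeta R p.
Section Any.
Variables (rho sigma tau : C).
Local Notation r1 := (toPGL (R1 p rho tau)).
Local Notation r2 := (toPGL (R2 p rho sigma)).
Local Notation r3 := (toPGL (R3 p sigma tau)).
Local Notation G := (reflection_group p rho sigma tau).

Lemma reflection_group_gens : [/\ G r1, G r2 & G r3].
Proof.
by split; apply: sub_generated; [left; left | left; right | right].
Qed.

Let sG : subgroup G := subgroup_generated _.

(** G and M = <A, r A> are commensurable when M contains G, the element x
    normalizes G with x^(n+1) in G, and A and r A lie in the cosets x^k G. *)
Lemma hypergeometric_companion (A r : GL C 3) (E F : 'M[C]_3)
    (x : PGL C 3) n :
  let M := generated [set toPGL A; (toPGL r * toPGL A)%g]%classic in
  (forall i j, GLmx r i j = (i == j)%:R + E i i0 * F i0 j) ->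
  krylov_cols A E -> krylov_rows A F -> \det E != 0 -> \det F != 0 ->
  M r1 -> M r2 -> M r3 ->
  G (x * r1 * x^-1)%g -> G (x * r2 * x^-1)%g -> G (x * r3 * x^-1)%g ->
  G (x ^+ n.+1)%g ->
  (exists k, G (x ^- k * toPGL A)%g) ->
  (exists k, G (x ^- k * (toPGL r * toPGL A))%g) ->
  has_hypergeometric_companion G.
Proof.
move=> M Er EA FA dE dF Mr1 Mr2 Mr3 x1 x2 x3 Gx GA GrA.
have [alpha [beta hM]] := hypergeometric_of_reflection Er EA FA dE dF.
exists alpha, beta, M; split; first by rewrite /M -toPGLM.
apply: commensurable_finite_index => //.
apply: (@finite_index_cyclic_extension _ _ x n _ Gx).
- by move=> y [[->|->]|->].
- by move=> y [->|->].
- by move=> y [[->|->]|->].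
Qed.

End Any.

Let z0 : z != 0 := zeta_neq0 R p.

(** J maps e_1 to e_2, e_2 to e_3 and e_3 to z^-1 e_1.  The factor z^-1 makes
    it conjugate R3 to R1 in spite of the asymmetric powers of z in the R_i.  The
    matrix R1 J is a companion matrix, with characteristic polynomial
    t^3 - tau t^2 + tau^* t - 1. *)
Lemma equilateral_companion tau :
  mirror_det z tau tau tau != 0 ->
  has_hypergeometric_companion (reflection_group p tau tau tau).
Proof.
move=> dN.
pose r1 := toPGL (R1 p tau tau); pose r2 := toPGL (R2 p tau tau).
pose r3 := toPGL (R3 p tau tau).
have [J EJ] : exists J : GL C 3, GLmx J = M3 0 0 z^-1 1 0 0 0 1 0.
  apply: GL_of_det; have -> : \det (M3 0 0 z^-1 1 0 0 0 1 0) = z^-1.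
    by rewrite det_mx33; ring.
  exact: invr_neq0.
have J1 : (toPGL J * r1 = r2 * toPGL J)%g.
  rewrite -!toPGLM; apply: toPGL_eq_mx.
  rewrite /= EJ /R1mx /R2mx -/z !mulmx_mx33.
  by apply: mx33_eq; field.
have J2 : (toPGL J * r2 = r3 * toPGL J)%g.
  rewrite -!toPGLM; apply: toPGL_eq_mx.
  rewrite /= EJ /R3mx /R2mx -/z !mulmx_mx33.
  by apply: mx33_eq; field.
have J3 : (toPGL J * r3 = r1 * toPGL J)%g.
  rewrite -!toPGLM; apply: toPGL_eq_mx.
  rewrite /= EJ /R3mx /R1mx -/z !mulmx_mx33.
  by apply: mx33_eq; field.
have JJ : (toPGL J ^+ 3 = 1)%g.
  rewrite expgS expg2 -(toPGLM J J) -(toPGLM J (GLmul J J)).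
  apply: (@toPGL_scalar _ _ z^-1); first exact: invr_neq0.
  by rewrite /= EJ !mulmx_mx33; apply: mx33_eq; field.
have [G1 G2 G3] := reflection_group_gens tau tau tau.
set x := toPGL J in J1 J2 J3 JJ.
pose E : 'M[C]_3 := M3 1 0 0 0 1 0 0 0 1.
pose F : 'M[C]_3 := M3 (z - 1) tau (- tau^*%C) tau (- tau^*%C) ((z - 1) / z)
   (- tau^*%C) ((z - 1) / z) (tau / z).
set M := generated [set x; (r1 * x)%g]%classic.
have sG : subgroup (reflection_group p tau tau tau) := subgroup_generated _.
have Mx : M x by apply: sub_generated; left.
have sM : subgroup M by exact: subgroup_generated.
have Mr1x : M (r1 * x)%g by apply: sub_generated; right.
have Mr1 : M r1.
  by rewrite -[r1](mulgK x); exact: (subgroupM sM Mr1x (subgroupV sM Mx)).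
have MJ r r' : (x * r = r' * x)%g -> M r -> M r'.
  move=> xr Mr; rewrite -[r'](mulgK x) -xr.
  exact: (subgroupM sM (subgroupM sM Mx Mr) (subgroupV sM Mx)).
have Mr2 := MJ _ _ J1 Mr1; have Mr3 := MJ _ _ J2 Mr2.
apply: (@hypergeometric_companion tau tau tau J (R1 p tau tau) E F x 2) => //.
- apply: ord3P; apply: ord3P; rewrite /= !mxE /= -?/z; by ring.
- apply: ord3P; rewrite EJ !mxE !big_ord_recl !big_ord0 !mxE /=; split; by ring.
- apply: ord3P; rewrite EJ !mxE !big_ord_recl !big_ord0 !mxE /=; split; by field.
- have -> : \det E = 1 by rewrite det_mx33; ring.
  exact: oner_neq0.
- apply: contra dN => /eqP dF.
  have -> : mirror_det z tau tau tau = - z ^+ 2 * \det F.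
    by rewrite det_mx33 /mirror_det; field.
  by rewrite dF mulr0.
- by rewrite J1 mulgK.
- by rewrite J2 mulgK.
- by rewrite J3 mulgK.
- by rewrite JJ; exact: (subgroup1 sG).
- by exists 1%N; rewrite expg1 mulVg; exact: (subgroup1 sG).
- by exists 1%N; rewrite expg1 -J3 mulKg.
Qed.

(** The conjugation R1 -> R2 -> R3 R1 R3^-1, R3 -> R3 has the conjugation by R3 as
    its square, so it has to be realized by a square root of R3; the condition
    a^2 = rho + rho^* makes the Hermitian products match. *)
Lemma isosceles_companion rho a :
  a^*%C = a -> a != 0 -> rho^*%C = a ^+ 2 - rho ->
  mirror_det z rho a a != 0 ->
  has_hypergeometric_companion (reflection_group p rho a a).
Proof.
move=> ca a0 crho dN.
pose r1 := toPGL (R1 p rho a); pose r2 := toPGL (R2 p rho a).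
pose r3 := toPGL (R3 p a a).
have [Q EQ] : exists Q : GL C 3, GLmx Q = M3 0 1 0 z 0 0 0 (z * a) (- z).
  apply: GL_of_det.
  have -> : \det (M3 0 1 0 z 0 0 0 (z * a) (- z)) = z ^+ 2.
    by rewrite det_mx33; ring.
  exact: expf_neq0.
set x := toPGL Q.
have x1 : (x * r1 = r2 * x)%g.
  rewrite -!toPGLM; apply: toPGL_eq_mx.
  rewrite /= EQ /R1mx /R2mx -/z !mulmx_mx33 ca crho.
  by apply: mx33_eq; ring.
have xx : (x ^+ 2 = r3)%g.
  rewrite expg2 -(toPGLM Q Q).
  apply: (@toPGL_scaled _ _ _ z) => //.
  rewrite /= EQ /R3mx -/z !mulmx_mx33 scale_mx33 ca.
  by apply: mx33_eq; ring.
have [G1 G2 G3] := reflection_group_gens rho a a.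
have sG : subgroup (reflection_group p rho a a) := subgroup_generated _.
pose E : 'M[C]_3 := M3 1 0 z 0 z 0 0 0 (z ^+ 2 * a).
pose F : 'M[C]_3 := M3 (z - 1) rho (- a)
  (rho * z) (z - 1 - z * a ^+ 2) (z * a)
  (z * (z - 1 - z * a ^+ 2)) (rho * z + z ^+ 2 * a ^+ 2) (- z ^+ 2 * a).
set M := generated [set x; (r1 * x)%g]%classic.
have sM : subgroup M by exact: subgroup_generated.
have Mx : M x by apply: sub_generated; left.
have Mr1x : M (r1 * x)%g by apply: sub_generated; right.
have Mr1 : M r1.
  by rewrite -[r1](mulgK x); exact: (subgroupM sM Mr1x (subgroupV sM Mx)).
have Mr2 : M r2.
  rewrite -[r2](mulgK x) -x1.
  exact: (subgroupM sM (subgroupM sM Mx Mr1) (subgroupV sM Mx)).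
have Mr3 : M r3 by rewrite -xx; exact: (subgroupX _ sM Mx).
apply: (@hypergeometric_companion rho a a Q (R1 p rho a) E F x 1) => //.
- by apply: ord3P; apply: ord3P; rewrite /= !mxE /= ?ca -?/z; ring.
- by apply: ord3P; rewrite EQ !mxE !big_ord_recl !big_ord0 !mxE /=; split; ring.
- by apply: ord3P; rewrite EQ !mxE !big_ord_recl !big_ord0 !mxE /=; split; ring.
- have -> : \det E = z ^+ 3 * a by rewrite det_mx33; ring.
  by rewrite mulf_neq0 ?expf_neq0.
- have -> : \det F = - (z * a * mirror_det z rho a a).
    by rewrite det_mx33 /mirror_det ca crho; ring.
  by rewrite oppr_eq0 !mulf_neq0.
- by rewrite x1 mulgK.
- have -> : (x * r2 * x^-1 = r3 * r1 * r3^-1)%g.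
    by rewrite -[r2](mulgK x) -x1 -xx expg2 invgM !mulgA.
  exact: (subgroupM sG (subgroupM sG G3 G1) (subgroupV sG G3)).
- by rewrite -/r3 -xx expg2 mulgA mulgK -expg2 xx.
- by rewrite xx.
- by exists 1%N; rewrite expg1 mulVg; exact: (subgroup1 sG).
- exists 1%N; have -> : (x ^- 1 * (r1 * x) = r3^-1 * r2 * r3)%g.
    by rewrite -xx expg1 expg2 invgM -!mulgA (mulgA r2) -x1 -!mulgA mulKg.
  exact: (subgroupM sG (subgroupM sG (subgroupV sG G3) G2) G3).
Qed.

Lemma companion_of_generators rho sigma tau (A r : GL C 3) (E F : 'M[C]_3) :
  let G := reflection_group p rho sigma tau in
  let M := generated [set toPGL A; (toPGL r * toPGL A)%g]%classic in
  (forall i j, GLmx r i j = (i == j)%:R + E i i0 * F i0 j) ->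
  krylov_cols A E -> krylov_rows A F -> \det E != 0 -> \det F != 0 ->
  M (toPGL (R1 p rho tau)) -> M (toPGL (R2 p rho sigma)) ->
  M (toPGL (R3 p sigma tau)) -> G (toPGL A) -> G (toPGL r) ->
  has_hypergeometric_companion G.
Proof.
move=> G M Er EA FA dE dF Mr1 Mr2 Mr3 GA Gr.
have [G1 G2 G3] := reflection_group_gens rho sigma tau.
have sG : subgroup G := subgroup_generated _.
apply: (@hypergeometric_companion _ _ _ A r E F 1%g 0) => //;
  rewrite ?invg1 ?mulg1 ?mul1g //; first exact: (subgroup1 sG).
  by exists 0%N; rewrite expg0 invg1 mul1g.
by exists 0%N; rewrite expg0 invg1 mul1g; exact: (subgroupM sG Gr GA).
Qed.

(** The hypothesis |rho|^2 = 2 is the braid relation of length 4 between R1 and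
    R2; it gives R1 A^2 R1 = R2 R1 A^2 for A = R2 R1 R3. *)
Lemma braid_334_companion rho :
  rho * rho^*%C = 2 ->
  mirror_det z rho 1 1 != 0 ->
  has_hypergeometric_companion (reflection_group p rho 1 1).
Proof.
move=> rho2 dN.
have rho0 : rho != 0.
  by apply/eqP => rho0; move: rho2 => /eqP; rewrite rho0 mul0r eq_sym pnatr_eq0.
have crho : rho^*%C = 2 / rho by rewrite -rho2 mulrC mulKf.
pose r1 := toPGL (R1 p rho 1); pose r2 := toPGL (R2 p rho 1).
pose r3 := toPGL (R3 p (1 : C) 1).
have [A Ex EA] : exists2 A : GL C 3, toPGL A = (r2 * r1 * r3)%g &
    GLmx A = M3 0 (rho + z) (- z) z (- 2 * z - z ^+ 2 * 2 / rho)
      (z + z ^+ 2 * 2 / rho) z (- z) z.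
  exists (GLmul (GLmul (R2 p rho 1) (R1 p rho 1)) (R3 p (1 : C) 1)).
    by rewrite !toPGLM.
  rewrite /= /R1mx /R2mx /R3mx -/z conjc1 crho !mulmx_mx33.
  by apply: mx33_eq; field.
set x := toPGL A in Ex.
have rel : (r1 * (x * x * r1) = r2 * r1 * (x * x))%g.
  rewrite -(toPGLM A A) -(toPGLM _ (R1 p rho 1)) -(toPGLM (R1 p rho 1)).
  rewrite -(toPGLM (R2 p rho 1)) -(toPGLM _ (GLmul A A)).
  apply: toPGL_eq_mx.
  do 2![rewrite [LHS]/= [RHS]/=]; rewrite !EA.
  rewrite /R1mx /R2mx -/z conjc1 crho !mulmx_mx33.
  by apply: mx33_eq; field.
pose f2 := (z - 1) * (rho + z) + rho * (- 2 * z - z ^+ 2 * 2 / rho) + z.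
pose f3 := - (z - 1) * z + rho * (z + z ^+ 2 * 2 / rho) - z.
pose E : 'M[C]_3 := M3 1 0 (z * rho) 0 z (- z ^+ 2) 0 z 0.
pose F : 'M[C]_3 := M3 (z - 1) rho (- 1) (rho * z - z) f2 f3
  (z * f2 + z * f3)
  ((rho * z - z) * (rho + z) + f2 * (- 2 * z - z ^+ 2 * 2 / rho) - f3 * z)
  (- (rho * z - z) * z + f2 * (z + z ^+ 2 * 2 / rho) + f3 * z).
set M := generated [set x; (r1 * x)%g]%classic.
have sM : subgroup M by exact: subgroup_generated.
have Mx : M x by apply: sub_generated; left.
have Mr1x : M (r1 * x)%g by apply: sub_generated; right.
have Mr1 : M r1.
  by rewrite -[r1](mulgK x); exact: (subgroupM sM Mr1x (subgroupV sM Mx)).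
have Mxx := subgroupM sM Mx Mx.
have Mr2r1 : M (r2 * r1)%g.
  rewrite -[(r2 * r1)%g](mulgK (x * x)%g) -rel.
  exact: (subgroupM sM (subgroupM sM Mr1 (subgroupM sM Mxx Mr1))
    (subgroupV sM Mxx)).
have Mr2 : M r2.
  by rewrite -[r2](mulgK r1); exact: (subgroupM sM Mr2r1 (subgroupV sM Mr1)).
have Mr3 : M r3.
  rewrite -[r3](mulKg (r2 * r1)%g) -Ex.
  exact: (subgroupM sM (subgroupV sM Mr2r1) Mx).
have [G1 G2 G3] := reflection_group_gens rho 1 1.
have sG : subgroup (reflection_group p rho 1 1) := subgroup_generated _.
apply: (@companion_of_generators rho 1 1 A (R1 p rho 1) E F) => //.
- move=> i j; rewrite -[GLmx _]/(R1mx p rho 1) /R1mx conjc1 -/z; move: i j.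
  by apply: ord3P; apply: ord3P; rewrite !mxE /=; ring.
- by apply: ord3P; rewrite EA !mxE !big_ord_recl !big_ord0 !mxE /=; split; field.
- by apply: ord3P; rewrite EA !mxE !big_ord_recl !big_ord0 !mxE /= /f2 /f3;
    split; field.
- have -> : \det E = z ^+ 3 by rewrite det_mx33; ring.
  by rewrite expf_neq0.
- have -> : \det F = - (z ^+ 3 * mirror_det z rho 1 1).
    by rewrite det_mx33 /mirror_det conjc1 crho /f2 /f3; field.
  by rewrite oppr_eq0 !mulf_neq0 ?expf_neq0.
- by rewrite -/x Ex; exact: (subgroupM sG (subgroupM sG G2 G1) G3).
Qed.

(** R2 and R3 commute and R1, R3 satisfy the braid relation of length 3, so that
    R3 R1 R2 conjugates R3 to R1, as a Coxeter element does for the first two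
    nodes of a linear diagram. *)
Lemma braid_23nn_companion rho :
  rho^*%C = rho -> rho != 0 ->
  mirror_det z rho 0 1 != 0 ->
  has_hypergeometric_companion (reflection_group p rho 0 1).
Proof.
move=> crho rho0 dN.
pose r1 := toPGL (R1 p rho 1); pose r2 := toPGL (R2 p rho 0).
pose r3 := toPGL (R3 p (0 : C) 1).
have [A Ex EA] : exists2 A : GL C 3, toPGL A = (r1 * r2)%g &
    GLmx A = M3 (z - z * rho ^+ 2) (rho * z) (- 1) (- z * rho) z 0 0 0 1.
  exists (GLmul (R1 p rho 1) (R2 p rho 0)); first by rewrite toPGLM.
  rewrite /= /R1mx /R2mx -/z conjc1 crho !mulmx_mx33.
  by apply: mx33_eq; ring.
set x := toPGL A in Ex.
have rel : (r3 * x * r3 = r1 * (r3 * x))%g.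
  rewrite -(toPGLM (R3 p (0 : C) 1) A) -(toPGLM _ (R3 p (0 : C) 1)).
  rewrite -(toPGLM (R1 p rho 1)).
  apply: toPGL_eq_mx.
  do 2![rewrite [LHS]/= [RHS]/=]; rewrite !EA.
  rewrite /R1mx /R3mx -/z conjc1 conjc0 !mulmx_mx33.
  by apply: mx33_eq; ring.
pose f1 := z * (z - z * rho ^+ 2).
pose E : 'M[C]_3 := M3 0 (- 1) (- (z - z * rho ^+ 2) - 1) 0 0 (z * rho) 1 1 1.
pose F : 'M[C]_3 := M3 z 0 (z - 1) f1 (z ^+ 2 * rho) (- 1)
  (f1 * (z - z * rho ^+ 2) - z ^+ 3 * rho ^+ 2)
  (f1 * rho * z + z ^+ 3 * rho) (- f1 - 1).
set M := generated [set x; (r3 * x)%g]%classic.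
have sM : subgroup M by exact: subgroup_generated.
have Mx : M x by apply: sub_generated; left.
have Mc : M (r3 * x)%g by apply: sub_generated; right.
have Mr3 : M r3.
  by rewrite -[r3](mulgK x); exact: (subgroupM sM Mc (subgroupV sM Mx)).
have Mr1 : M r1.
  rewrite -[r1](mulgK (r3 * x)%g) -rel.
  exact: (subgroupM sM (subgroupM sM Mc Mr3) (subgroupV sM Mc)).
have Mr2 : M r2.
  rewrite -[r2](mulKg r1) -Ex.
  exact: (subgroupM sM (subgroupV sM Mr1) Mx).
have [G1 G2 G3] := reflection_group_gens rho 0 1.
have sG : subgroup (reflection_group p rho 0 1) := subgroup_generated _.
apply: (@companion_of_generators rho 0 1 A (R3 p (0 : C) 1) E F) => //.
- move=> i j; rewrite -[GLmx _]/(R3mx p 0 1) /R3mx conjc0 -/z; move: i j.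
  by apply: ord3P; apply: ord3P; rewrite !mxE /=; ring.
- by apply: ord3P; rewrite EA !mxE !big_ord_recl !big_ord0 !mxE /=; split; ring.
- by apply: ord3P; rewrite EA !mxE !big_ord_recl !big_ord0 !mxE /= /f1;
    split; ring.
- have -> : \det E = - (z * rho) by rewrite det_mx33; ring.
  by rewrite oppr_eq0 mulf_neq0.
- have -> : \det F = z ^+ 3 * rho * mirror_det z rho 0 1.
    by rewrite det_mx33 /mirror_det conjc1 conjc0 crho /f1; ring.
  by rewrite !mulf_neq0 ?expf_neq0.
- by rewrite -/x Ex; exact: (subgroupM sG G1 G2).
Qed.

(** Here z = i, so R1 has order 4.  The matrix g maps e_1 to - e_1, e_2 to e_3
    and e_3 to R2 e_3 up to a scalar; it has eigenvalues -1, -1 and a third one,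
    and g^3 = - 1. *)
Lemma E2_companion (r s : C) :
  z ^+ 2 = -1 -> r^*%C = r -> r ^+ 2 = 2 -> s ^+ 2 = s - 1 -> s^*%C = 1 - s ->
  has_hypergeometric_companion (reflection_group p r s r).
Proof.
move=> z2 cr rr ss cs.
have r0 : r != 0.
  by apply/eqP => r0; move: rr => /eqP; rewrite r0 expr0n eq_sym pnatr_eq0.
pose r1 := toPGL (R1 p r r); pose r2 := toPGL (R2 p r s).
pose r3 := toPGL (R3 p s r).
have [g Eg] : exists g : GL C 3, GLmx g = M3 (-1) 0 0 0 0 (1 - s) 0 1 (- s).
  apply: GL_of_det.
  have -> : \det (M3 (-1) 0 0 0 0 (1 - s) 0 1 (- s)) = 1 - s.
    by rewrite det_mx33; ring.
  rewrite -cs conjc_eq0; apply: contra_eq_neq ss => ->.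
  by rewrite expr0n sub0r eq_sym oppr_eq0 oner_neq0.
set x := toPGL g.
have x1 : (x * r1 = r1 * x)%g.
  rewrite -!toPGLM; apply: toPGL_eq_mx.
  rewrite /= Eg /R1mx -/z !mulmx_mx33 cr.
  by apply: mx33_eq; ring: ss.
have x2 : (x * r2 = r3 * x)%g.
  rewrite -!toPGLM; apply: toPGL_eq_mx.
  rewrite /= Eg /R2mx /R3mx -/z !mulmx_mx33 cr cs.
  by apply: mx33_eq; ring: ss.
have x3 : (r3 * x * r3 = r2 * r3 * x)%g.
  rewrite -(toPGLM (R3 p s r)) -(toPGLM (R2 p r s)) -(toPGLM _ g).
  rewrite -(toPGLM _ (R3 p s r)).
  apply: toPGL_eq_mx.
  rewrite /= Eg /R2mx /R3mx -/z !mulmx_mx33 cr cs.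
  by apply: mx33_eq; ring: ss rr.
have xxx : (x ^+ 3 = 1)%g.
  rewrite expgS expg2 -(toPGLM g g) -(toPGLM g (GLmul g g)).
  apply: (@toPGL_scalar _ _ (-1)); first by rewrite oppr_eq0 oner_neq0.
  by rewrite /= Eg !mulmx_mx33; apply: mx33_eq; ring: ss.
have r1X4 : (r1 ^+ 4 = 1)%g.
  have [B EB EBmx] : exists2 B : GL C 3, toPGL B = (r1 * r1)%g &
      GLmx B = M3 (-1) ((1 + z) * r) (- (1 + z) * r) 0 1 0 0 0 1.
    exists (GLmul (R1 p r r) (R1 p r r)); first by rewrite toPGLM.
    rewrite /= /R1mx -/z !mulmx_mx33 cr.
    by apply: mx33_eq; ring: z2.
  rewrite -[4%N]/(2 * 2)%N expgnA !expg2 -EB -(toPGLM B B).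
  apply: (@toPGL_scalar _ _ 1); first exact: oner_neq0.
  by rewrite /= EBmx !mulmx_mx33; apply: mx33_eq; ring: z2.
have [A Ex EA] : exists2 A : GL C 3, toPGL A = (x * r1)%g &
    GLmx A = M3 (- z) (- r) r 0 0 (1 - s) 0 1 (- s).
  exists (GLmul g (R1 p r r)); first by rewrite toPGLM.
  rewrite /= Eg /R1mx -/z !mulmx_mx33 cr.
  by apply: mx33_eq; ring.
pose f12 := 2 * z + s.
pose f13 := - 2 * z + (z - 1) * (1 - s) + 1 - s.
pose E : 'M[C]_3 := M3 0 (- r) (r * (z + 1)) 1 0 (1 - s) 0 1 (- s).
pose F : 'M[C]_3 := M3 (- z * r) (z - 1) s (- r) f12 f13
  (z * r) (r ^+ 2 + f13) (- r ^+ 2 + f12 * (1 - s) - f13 * s).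
have [G1 G2 G3] := reflection_group_gens r s r.
have sG : subgroup (reflection_group p r s r) := subgroup_generated _.
set M := generated [set toPGL A; (r2 * toPGL A)%g]%classic.
have sM : subgroup M by exact: subgroup_generated.
have MA : M (x * r1)%g by rewrite -Ex; apply: sub_generated; left.
have MrA : M (r2 * (x * r1))%g by rewrite -Ex; apply: sub_generated; right.
have Mr2 : M r2.
  rewrite -[r2](mulgK (x * r1)%g); exact: (subgroupM sM MrA (subgroupV sM MA)).
have Mx : M x.
  (* 4 is congruent to 1 modulo the order of g and to 0 modulo that of R1. *)
  have -> : x = ((x * r1) ^+ 4)%g.
    by rewrite expgMn // r1X4 mulg1 expgSr xxx mul1g.
  exact: (subgroupX _ sM MA).
have Mr1 : M r1.
  by rewrite -[r1](mulKg x); exact: (subgroupM sM (subgroupV sM Mx) MA).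
have Mr3 : M r3.
  rewrite -[r3](mulgK x) -x2.
  exact: (subgroupM sM (subgroupM sM Mx Mr2) (subgroupV sM Mx)).
have xr3 : (x * r3 * x^-1 = r3^-1 * r2 * r3)%g.
  by rewrite -[(x * r3)%g](mulKg r3) (mulgA r3) x3 !mulgA mulgK.
apply: (@hypergeometric_companion r s r A (R2 p r s) E F x 2) => //.
- move=> i j; rewrite -[GLmx _]/(R2mx p r s) /R2mx cr -/z; move: i j.
  by apply: ord3P; apply: ord3P; rewrite !mxE /=; ring.
- by apply: ord3P; rewrite EA !mxE !big_ord_recl !big_ord0 !mxE /=; split; ring.
- by apply: ord3P; rewrite EA !mxE !big_ord_recl !big_ord0 !mxE /= /f12 /f13;
    split; ring: z2 rr ss.
- have -> : \det E = r * (z + 1 - s) by rewrite det_mx33; ring.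
  rewrite mulf_neq0 // subr_eq0; apply/eqP => zs.
  have : z = 0.
    have z2' : (z + 1) ^+ 2 = z by rewrite zs ss -zs addrK.
    have : z = (z + 1) ^+ 2 - z by ring: z2.
    by rewrite z2' subrr.
  exact/eqP.
- have -> : \det F = r * (z + 2 * s - 1).
    by rewrite det_mx33 /f12 /f13; ring: z2 rr ss.
  rewrite mulf_neq0 //; apply/eqP => zs.
  have /eqP : 2 = 0 :> C.
    have zs' : z = 1 - 2 * s by rewrite -[LHS]subr0 -zs; ring.
    by rewrite -(subrr (z ^+ 2)) {1}z2 zs'; ring: ss.
  by rewrite pnatr_eq0.
- by rewrite x1 mulgK.
- by rewrite x2 mulgK.
- rewrite -/r3 xr3.
  exact: (subgroupM sG (subgroupM sG (subgroupV sG G3) G2) G3).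
- by rewrite xxx; exact: (subgroup1 sG).
- by exists 1%N; rewrite expg1 Ex mulKg.
- exists 1%N; rewrite expg1 Ex -/r2.
  have -> : (x^-1 * (r2 * (x * r1)) = r3^-1 * r2 * r3 * r1)%g.
    have xV : (x^-1 = x * x)%g.
      by apply: (mulgI x); rewrite mulgV -expg2 -expgS xxx.
    rewrite -xr3 -[r3](mulgK x) -x2 !mulgA -xV -(mulgA _ x^-1 x^-1)%g.
    by rewrite -invgM -xV invgK.
  exact: (subgroupM sG (subgroupM sG (subgroupM sG (subgroupV sG G3) G2) G3) G1).
Qed.

End Params.
End Families.

(** * Cosines of some rational angles *)

Section Trigonometry.
Variable R : realType.
Local Open Scope ring_scope.
Implicit Types x y : R.

Lemma cos_double x : cos (2 * x) = 2 * cos x ^+ 2 - 1.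
Proof.
rewrite (_ : 2 * x = x + x) ?cosD; last by ring.
have := cos2Dsin2 x; lra.
Qed.

Lemma sin_double x : sin (2 * x) = 2 * sin x * cos x.
Proof. rewrite (_ : 2 * x = x + x) ?sinD; last by ring. ring. Qed.

Lemma cos_triple x : cos (3 * x) = 4 * cos x ^+ 3 - 3 * cos x.
Proof.
rewrite (_ : 3 * x = 2 * x + x) ?cosD ?cos_double ?sin_double; last by ring.
have -> : 2 * sin x * cos x * sin x = 2 * cos x * (1 - cos x ^+ 2).
  by rewrite -(cos2Dsin2 x); ring.
ring.
Qed.

Lemma cos_pi_sub x : cos (pi - x) = - cos x.
Proof. by rewrite cosB cospi sinpi mul0r addr0 mulN1r. Qed.

Lemma sin_pi_sub x : sin (pi - x) = sin x.
Proof. by rewrite sinB cospi sinpi mul0r add0r mulN1r opprK. Qed.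

Lemma cos_gt0_lt x : 0 <= x < pi / 2 -> 0 < cos x.
Proof.
move=> xP; apply: cos_gt0_pihalf; have := pi_gt0 R; lra.
Qed.

Lemma cos_pi3 : cos (pi / 3) = 1 / 2 :> R.
Proof.
have pi0 := pi_gt0 R.
have c0 : 0 < cos (pi / 3 : R) by apply: cos_gt0_lt; lra.
have := cos_double (pi / 3 : R).
rewrite (_ : 2 * (pi / 3) = pi - pi / 3) ?cos_pi_sub => [E|]; last by field.
nra.
Qed.

Lemma sin_pi3 : sin (pi / 3) = Num.sqrt 3 / 2 :> R.
Proof.
have s0 : 0 < sin (pi / 3) :> R by apply: sin_gt0_pi; have := pi_gt0 R; lra.
have b0 : 0 < Num.sqrt 3 :> R by rewrite sqrtr_gt0.
have b2 : Num.sqrt 3 ^+ 2 = 3 :> R by rewrite sqr_sqrtr.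
have := cos2Dsin2 (pi / 3 : R); rewrite cos_pi3; nra.
Qed.

Lemma cos_pi4 : cos (pi / 4) ^+ 2 = 1 / 2 :> R.
Proof.
have := cos_double (pi / 4 : R).
rewrite (_ : 2 * (pi / 4) = pi / 2) ?cos_pihalf => [E|]; first by lra.
by field.
Qed.

Lemma cos_pi6 : cos (pi / 6) ^+ 2 = 3 / 4 :> R.
Proof.
have := cos_double (pi / 6 : R).
rewrite (_ : 2 * (pi / 6) = pi / 3) ?cos_pi3 => [E|]; first by lra.
by field.
Qed.

(** From cos (3 x) = - cos (2 x) for x = pi / 5. *)
Lemma cos_pi5 : [/\ 4 * cos (pi / 5) ^+ 2 = 2 * cos (pi / 5) + 1 :> R,
  3 / 4 < cos (pi / 5) :> R & cos (pi / 5) < 1 :> R].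
Proof.
have pi0 := pi_gt0 R; set c := cos _.
have c0 : 0 < c by apply: cos_gt0_lt; lra.
have : 4 * c ^+ 3 - 3 * c = - (2 * c ^+ 2 - 1).
  rewrite -cos_triple -cos_double -cos_pi_sub; congr cos; by field.
move=> E; have E1 : 4 * c ^+ 2 = 2 * c + 1.
  have : (c + 1) * (4 * c ^+ 2 - (2 * c + 1)) = 0.
    by rewrite -[RHS](subrr (4 * c ^+ 3 - 3 * c)) {2}E; ring.
  by move/eqP; rewrite mulf_eq0 => /orP[/eqP|/eqP]; lra.
by split=> //; nra.
Qed.

Lemma sqrt5E : Num.sqrt 5 = 4 * cos (pi / 5) - 1 :> R.
Proof.
have [E c1 _] := cos_pi5; have s0 : 0 <= 4 * cos (pi / 5) - 1 :> R by lra.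
rewrite -[RHS]ger0_norm // -sqrtr_sqr; congr Num.sqrt; nra.
Qed.

(** From cos (4 x) = - cos (3 x) for x = pi / 7. *)
Lemma cos_pi7 (c := cos (pi / 7) : R) :
  0 < c /\ 8 * c ^+ 3 = 4 * c ^+ 2 + 4 * c - 1.
Proof.
have pi0 := pi_gt0 R.
have c0 : 0 < c by apply: cos_gt0_lt; lra.
split=> //.
have : cos (2 * (2 * (pi / 7))) = - cos (3 * (pi / 7)) :> R.
  by rewrite -cos_pi_sub; congr cos; by field.
rewrite !cos_double cos_triple -/c => E.
have /eqP : (c + 1) * (8 * c ^+ 3 - (4 * c ^+ 2 + 4 * c - 1)) = 0.
  rewrite -[RHS](subrr (- (4 * c ^+ 3 - 3 * c))) -{1}E; ring.
by rewrite mulf_eq0 => /orP[/eqP|/eqP]; lra.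
Qed.

Lemma angle_bounds (p : int) (q : nat) : (1 < q)%N -> q%:Z <= p ->
  let t : R := pi / p%:~R in
  [/\ 0 < sin t, 0 <= cos (pi / q%:R : R) & cos (pi / q%:R) <= cos t].
Proof.
move=> q1 qp t; have pi0 := pi_gt0 R.
have q2 : 2 <= q%:R :> R by rewrite ler_nat.
have pq : q%:R <= p%:~R :> R by rewrite -[q%:R]/(q%:Z%:~R) ler_int.
have t0 : 0 < t by rewrite divr_gt0 //; lra.
have tq : t <= pi / q%:R by rewrite ler_pM2l // lef_pV2 // posrE; lra.
have q2' : pi / q%:R <= pi / 2 :> R by rewrite ler_pM2l // lef_pV2 // posrE; lra.
split; first by apply: sin_gt0_pi; lra.
  by apply: cos_ge0_pihalf; lra.
rewrite leNgt ltr_cos ?in_itv /= -?leNgt //; lra.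
Qed.

End Trigonometry.

(** * Nondegeneracy of the Hermitian form *)

Section Nondegenerate.
Variable R : realType.
Local Open Scope ring_scope.
Local Open Scope complex_scope.
Local Notation C := R[i].

Lemma expiD (x y : R) : expi (x + y) = expi x * expi y.
Proof.
by rewrite /expi cosD sinD; simpc; rewrite [sin x * cos y + _]addrC.
Qed.

Lemma expi_conj (x : R) : (expi x)^*%C = expi (- x).
Proof. by rewrite /expi cosN sinN. Qed.

Lemma zetaE (p : int) (t := pi / p%:~R : R) :
  zeta R p = ((cos t)%:C + 'i%C * (sin t)%:C) ^+ 2.
Proof.
rewrite (_ : _ + _ = expi t); last by rewrite [RHS]complexE.
by rewrite expr2 -expiD /zeta; congr expi; rewrite /t; ring.
Qed.

(** With u = exp (i t) and z = u^2, one has z - 1 = 2 i u sin t, and mirror_det is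
    2 i u^3 times the displayed real number, which is itself - 1 / 2 times the
    determinant of H. *)
Lemma mirror_det_neq0 (p : int) (rho sigma tau : C) (S X Y : R)
    (t := pi / p%:~R : R) :
  rho * rho^*%C + sigma * sigma^*%C + tau * tau^*%C = S%:C ->
  rho * sigma * tau = X +i* Y ->
  sin t * (S - X - 4 * sin t ^+ 2) + cos t * Y != 0 ->
  mirror_det (zeta R p) rho sigma tau != 0.
Proof.
move=> ES EXY D0.
have cEXY : rho^*%C * sigma^*%C * tau^*%C = X%:C - 'i%C * Y%:C.
  by rewrite -!rmorphM EXY [LHS]complexE /= rmorphN mulrN.
rewrite /mirror_det ES cEXY EXY [_ +i* _]complexE /= zetaE -/t.
set c := cos t in D0 *; set s := sin t in D0 *.
pose u := c%:C + 'i%C * s%:C.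
have u0 : u != 0 by have := expi_neq0 t; rewrite [expi t]complexE.
have i2 : 'i%C ^+ 2 = -1 :> C := sqr_i R.
have cs : s%:C ^+ 2 = 1 - c%:C ^+ 2 :> C.
  rewrite -!rmorphXn -[1]/(1%:C) -rmorphB /=; congr (_%:C).
  by have := cos2Dsin2 t; rewrite -/c -/s; lra.
rewrite [X in X != 0](_ : _ = 2 * 'i%C * u ^+ 3 *
  (s * (S - X - 4 * s ^+ 2) + c * Y)%:C); last first.
  by rewrite /u; ring: i2 cs.
have i0 : 'i%C != 0 :> C by rewrite -sqrf_eq0 i2 oppr_eq0 oner_eq0.
have D0' : (s * (S - X - 4 * s ^+ 2) + c * Y)%:C != 0 :> C.
  by rewrite eq_complex /= negb_and D0.
by rewrite !mulf_neq0 ?expf_neq0 ?pnatr_eq0.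
Qed.

(** For Y >= 0, positivity for all p >= q reduces to a bound at q, because
    cos (pi / p) increases with p. *)
Lemma mirror_det_neq0_ge0 (q : nat) (p : int) (rho sigma tau : C) (S X Y : R) :
  (1 < q)%N -> q%:Z <= p ->
  rho * rho^*%C + sigma * sigma^*%C + tau * tau^*%C = S%:C ->
  rho * sigma * tau = X +i* Y ->
  0 <= Y -> 4 * (1 - cos (pi / q%:R) ^+ 2) < S - X ->
  mirror_det (zeta R p) rho sigma tau != 0.
Proof.
move=> q1 qp ES EX Y0 SX; have [s0 cq cp] := angle_bounds R q1 qp.
apply: (mirror_det_neq0 ES EX); rewrite gt_eqF //.
have cs := cos2Dsin2 (pi / p%:~R : R).
have cY : 0 <= cos (pi / p%:~R) * Y by rewrite mulr_ge0 //; lra.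
suff: 0 < sin (pi / p%:~R) * (S - X - 4 * sin (pi / p%:~R) ^+ 2) by lra.
by rewrite mulr_gt0 //; nra.
Qed.

(** The same at q = 3 with equality allowed in 4 sin^2 (pi / 3) = 3 <= S - X,
    compensated by Y > 0. *)
Lemma mirror_det_neq0_gt0 (p : int) (rho sigma tau : C) (S X Y : R) :
  3%:Z <= p ->
  rho * rho^*%C + sigma * sigma^*%C + tau * tau^*%C = S%:C ->
  rho * sigma * tau = X +i* Y ->
  0 < Y -> 3 <= S - X ->
  mirror_det (zeta R p) rho sigma tau != 0.
Proof.
move=> p3 ES EX Y0 SX.
have [s0] := @angle_bounds R p 3 isT p3; rewrite cos_pi3 => _ cp.
apply: (mirror_det_neq0 ES EX); rewrite gt_eqF //.
have cs := cos2Dsin2 (pi / p%:~R : R).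
have cY : 0 < cos (pi / p%:~R) * Y by rewrite mulr_gt0 //; lra.
suff: 0 <= sin (pi / p%:~R) * (S - X - 4 * sin (pi / p%:~R) ^+ 2) by lra.
by rewrite mulr_ge0 //; nra.
Qed.

End Nondegenerate.

(** * The rows of the list *)

Section Rows.
Variable R : realType.
Local Open Scope ring_scope.
Local Open Scope complex_scope.
Local Notation C := R[i].

Lemma half_complex (x : C) :
  x / 2 = (complex.Re x / 2) +i* (complex.Im x / 2).
Proof.
have -> : 2 = 2%:C :> C by rewrite rmorph_nat.
by case: x => a b; rewrite -fmorphV /=; simpc.
Qed.

Lemma expi_conjM (x : R) : expi x * (expi x)^*%C = 1.
Proof.
by rewrite expi_conj -expiD subrr /expi cos0 sin0.
Qed.

Lemma expi_cube (x : R) : expi x ^+ 3 = expi (3 * x).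
Proof.
by rewrite !exprS expr0 mulr1 -!expiD; congr expi; ring.
Qed.

Lemma complex_cube (a b : R) :
  (a +i* b) * (a +i* b) * (a +i* b) =
    (a ^+ 3 - 3 * a * b ^+ 2) +i* (3 * a ^+ 2 * b - b ^+ 3).
Proof. by simpc; congr (_ +i* _); ring. Qed.

Lemma complex_norm2 (a b : R) : (a +i* b) * (a +i* b)^*%C = (a ^+ 2 + b ^+ 2)%:C.
Proof. by simpc; congr (_ +i* _); ring. Qed.

Lemma all_ge (ps : seq int) (q : nat) p :
  p \in ps -> all (fun r : int => q%:Z <= r) ps -> q%:Z <= p.
Proof. by move=> pp /allP; apply. Qed.

Lemma first_quadrant (m : nat) : (3 < m)%N ->
  0 < sin (2 * pi / m%:R) :> R /\ 0 <= cos (2 * pi / m%:R) :> R.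
Proof.
move=> m4; have pi0 := pi_gt0 R.
have m4' : 4 <= m%:R :> R by rewrite ler_nat.
have x0 : 0 < 2 * pi / m%:R :> R by rewrite divr_gt0 //; lra.
have x1 : 2 * pi / m%:R <= pi / 2 :> R by rewrite ler_pdivrMr; nra.
by split; [apply: sin_gt0_pi; lra | apply: cos_ge0_pihalf; lra].
Qed.

Lemma family_nnnm_mirror_det n m ps (tau : C) p :
  family_nnnm n m ps tau -> p \in ps ->
  mirror_det (zeta R p) tau tau tau != 0.
Proof.
have pi0 := pi_gt0 R.
case=> [{n}m' ps' mps||||||] pp.
- set x : R := 2 * pi / m'%:R.
  have ET : let t := - expi (- (2 * pi / (3 * m'%:R))) in
      t * t^*%C + t * t^*%C + t * t^*%C = (3 : R)%:C
      /\ t * t * t = (- cos x) +i* sin x.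
    move=> t; split.
      by rewrite rmorphN mulrNN expi_conjM rmorph_nat; ring.
    rewrite (_ : t * t * t = - (expi (- (2 * pi / (3 * m'%:R))) ^+ 3)).
      2: by rewrite /t; ring.
    rewrite expi_cube (_ : 3 * _ = - x).
      by rewrite /expi cosN sinN; simpc; rewrite ?opprK.
    rewrite /x; have [->|m0] := eqVneq (m'%:R : R) 0.
      by rewrite mulr0 !invr0; ring.
    by field.
  have [m4|m4] := ltnP 3 m'.
    have [sx cx] := first_quadrant m4.
    apply: (mirror_det_neq0_gt0 _ ET.1 ET.2) => //; last by rewrite /x; lra.
    apply: all_ge pp _; move: mps m4; rewrite !inE.
    by do 9?[case/orP=> [/eqP[-> ->] //|]]; move/eqP=> [-> ->].
  move: mps m4 ET; rewrite !inE => /orP[/eqP[Em Eps]|]; last first.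
    case/orP=> [/eqP[Em Eps]|].
      rewrite /x Em => _ ET.
      have x3 : 2 * pi / 3 = pi - pi / 3 :> R by field.
      apply: (mirror_det_neq0_ge0 (q := 4) _ _ ET.1 ET.2) => //;
        rewrite ?x3 ?cos_pi4 ?cos_pi_sub ?sin_pi_sub ?cos_pi3.
      - by rewrite Eps in pp; exact: all_ge pp _.
      - by rewrite sin_pi3 divr_ge0 ?sqrtr_ge0.
      - lra.
    by do 7?[case/orP=> [/eqP[-> _] //|]]; move/eqP=> [-> _].
  rewrite /x Em (_ : 2 * pi / 2 = pi) => [_ ET|]; last by field.
  have [c5E c5 _] := cos_pi5 R.
  apply: (mirror_det_neq0_ge0 (q := 5) _ _ ET.1 ET.2) => //;
    rewrite ?cospi ?sinpi //; last by lra.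
  by rewrite Eps in pp; exact: all_ge pp _.
- have s7 : Num.sqrt 7 ^+ 2 = 7 :> R by rewrite sqr_sqrtr.
  have -> : (- 1 - 'i%C * (Num.sqrt 7)%:C) / 2 =
      (- 1 / 2) +i* (- Num.sqrt 7 / 2) :> C.
    by rewrite half_complex /=; congr (_ +i* _); ring.
  have s0 : 0 < Num.sqrt 7 :> R by rewrite sqrtr_gt0.
  have pq : 3%:Z <= p by exact: all_ge pp _.
  apply: (@mirror_det_neq0_ge0 _ 3 _ _ _ _ 6 (5 / 2) (Num.sqrt 7 / 2) isT
    pq).
  + by rewrite complex_norm2 -!rmorphD /=; congr (_%:C); field: s7.
  + by rewrite complex_cube; congr (_ +i* _); field: s7.
  + lra.
  + by rewrite cos_pi3; lra.
- have b2 : Num.sqrt 3 ^+ 2 = 3 :> R by rewrite sqr_sqrtr.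
  set b : R := Num.sqrt 3 in b2.
  have -> : expi (pi / 3) + expi (- (pi / 6)) =
      (1 / 2 + b / 2) +i* (b / 2 - 1 / 2) :> C.
    rewrite (_ : - (pi / 6) = pi / 3 - pi / 2); last by field.
    rewrite expiD /expi cosN sinN cos_pihalf sin_pihalf cos_pi3 sin_pi3 -/b; simpc.
    by congr (_ +i* _); ring.
  have pq : 3%:Z <= p by exact: all_ge pp _.
  apply: (@mirror_det_neq0_ge0 _ 3 _ _ _ _ 6 2 2 isT pq).
  + by rewrite complex_norm2 -!rmorphD /=; congr (_%:C); field: b2.
  + by rewrite complex_cube; congr (_ +i* _); field: b2.
  + lra.
  + by rewrite cos_pi3; lra.
- have [s5 s3] : Num.sqrt 5 ^+ 2 = 5 :> R /\ Num.sqrt 3 ^+ 2 = 3 :> R.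
    by rewrite !sqr_sqrtr.
  have [s50 s30] : 0 < Num.sqrt 5 :> R /\ 0 < Num.sqrt 3 :> R.
    by rewrite !sqrtr_gt0.
  set a : R := Num.sqrt 5 in s5 s50 *; set b : R := Num.sqrt 3 in s3 s30 *.
  have -> : expi (- (pi / 9)) * (a%:C + 'i%C * b%:C) / 2 =
      expi (- (pi / 9)) * ((a / 2) +i* (b / 2)) :> C.
    by rewrite -mulrA half_complex /=; congr (_ * (_ +i* _)); ring.
  have pq : 2%:Z <= p by exact: all_ge pp _.
  apply: (@mirror_det_neq0_ge0 _ 2 _ _ _ _ 6 ((9 - a) / 4) ((3 * b + a * b) / 4)
    isT pq).
  + rewrite rmorphM mulrACA expi_conjM mul1r complex_norm2 -!rmorphD /=.
    by congr (_%:C); field: s5 s3.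
  + rewrite -[LHS]/((_ * _) * _) (_ : _ * _ * _ = expi (- (pi / 9)) ^+ 3 *
      ((a / 2 +i* (b / 2)) * (a / 2 +i* (b / 2)) * (a / 2 +i* (b / 2)))).
      rewrite expi_cube complex_cube (_ : 3 * - (pi / 9) = - (pi / 3)).
        rewrite /expi cosN sinN cos_pi3 sin_pi3 -/b; simpc.
        by congr (_ +i* _); field: s5 s3.
      by field.
    by ring.
  + by rewrite divr_ge0 //; nra.
  + by rewrite cos_pihalf; nra.
- have [c2 c0 _] := cos_pi5 R; set c := cos (pi / 5) in c2 c0.
  have -> : (1 + (Num.sqrt 5)%:C) / 2 = (2 * c) +i* 0 :> C.
    by rewrite half_complex /= sqrt5E -/c; congr (_ +i* _); field.
  have pq : 3%:Z <= p by exact: all_ge pp _.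
  apply: (@mirror_det_neq0_ge0 _ 3 _ _ _ _ (12 * c ^+ 2) (8 * c ^+ 3) 0
    isT pq).
  + by rewrite complex_norm2 -!rmorphD /=; congr (_%:C); ring.
  + by rewrite complex_cube; congr (_ +i* _); ring.
  + lra.
  + rewrite cos_pi3; nra.
- have x0 : 0 < 2 * (pi : R) / 5 < (pi : R) / 2 by lra.
  have s0 : 0 < sin (2 * pi / 5 : R) by apply: sin_gt0_pi; lra.
  have c0 : 0 < cos (2 * pi / 5 : R) by apply: cos_gt0_lt; lra.
  set s := sin _ in s0; set c := cos _ in c0.
  have cs : s ^+ 2 = 1 - c ^+ 2.
    by have := cos2Dsin2 (2 * pi / 5 : R); rewrite -/c -/s; lra.
  have c1 : c < 1 by nra.
  set u : C := expi (2 * pi / 15).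
  have uu : u * u^*%C = 1 := expi_conjM _.
  have u3 : u ^+ 3 = c +i* s.
    by rewrite expi_cube; congr expi; field.
  have v3 : u^*%C ^+ 3 = c -i* s by rewrite -rmorphXn u3.
  rewrite -expi_conj -/u.
  rewrite [expi (4 * _ / _)](_ : _ = u * u); last first.
    by rewrite -expiD; congr expi; field.
  have cT : (u * u + u^*%C)^*%C = u^*%C * u^*%C + u.
    by rewrite rmorphD rmorphM; congr (_ + _); exact: conjcK.
  have pq : 2%:Z <= p by exact: all_ge pp _.
  apply: (@mirror_det_neq0_ge0 _ 2 _ _ _ _ (6 + 6 * c)
    (2 * c ^+ 2 + 4 * c + 2) (2 * s * (c + 1)) isT pq).
  + rewrite cT; transitivity (3 * (2 + u ^+ 3 + u^*%C ^+ 3)).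
      by ring: uu.
    rewrite u3 v3 -[3]/(3%:R) -[2]/(2%:R) -!(rmorph_nat (real_complex R)).
    by simpc; congr (_ +i* _); ring.
  + transitivity ((u ^+ 3) * (u ^+ 3) + 3 * u ^+ 3 + 3 + u^*%C ^+ 3).
      by ring: uu.
    rewrite u3 v3 -[3]/(3%:R) -!(rmorph_nat (real_complex R)).
    by simpc; congr (_ +i* _); ring: cs.
  + by rewrite !mulr_ge0 //; lra.
  + by rewrite cos_pihalf; nra.
- have s2 : Num.sqrt 2 ^+ 2 = 2 :> R by rewrite sqr_sqrtr.
  have s0 : 0 < Num.sqrt 2 :> R by rewrite sqrtr_gt0.
  have -> : - 1 + 'i%C * (Num.sqrt 2)%:C = - 1 +i* Num.sqrt 2 :> C.
    by simpc.
  have pq : 3%:Z <= p by exact: all_ge pp _.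
  apply: (@mirror_det_neq0_ge0 _ 3 _ _ _ _ 9 5 (Num.sqrt 2) isT
    pq).
  + by rewrite complex_norm2 -!rmorphD /=; congr (_%:C); ring: s2.
  + by rewrite complex_cube; congr (_ +i* _); ring: s2.
  + lra.
  + by rewrite cos_pi3; lra.
Qed.

Lemma isosceles_mirror_det (q : nat) (p : int) (x y a : R) :
  (1 < q)%N -> q%:Z <= p -> 0 <= y ->
  4 * (1 - cos (pi / q%:R) ^+ 2) <
    x ^+ 2 + y ^+ 2 + 2 * a ^+ 2 - x * a ^+ 2 ->
  mirror_det (zeta R p) (x +i* y) a%:C a%:C != 0.
Proof.
move=> q1 qp y0 SX.
apply: (@mirror_det_neq0_ge0 _ q p _ _ _ (x ^+ 2 + y ^+ 2 + 2 * a ^+ 2)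
  (x * a ^+ 2) (y * a ^+ 2) q1 qp) => //.
- by rewrite complex_norm2; simpc; congr (_ +i* _); ring.
- by simpc; congr (_ +i* _); ring.
- by rewrite mulr_ge0 ?sqr_ge0.
Qed.

Lemma isosceles_companion_real p (x y a : R) :
  0 < a -> a ^+ 2 = 2 * x ->
  mirror_det (zeta R p) (x +i* y) a%:C a%:C != 0 ->
  has_hypergeometric_companion (reflection_group p (x +i* y) a%:C a%:C).
Proof.
move=> a0 ax dN; apply: isosceles_companion dN.
- exact: conjc_real.
- by rewrite eq_complex /= gt_eqF.
- by rewrite expr2; simpc; congr (_ +i* _); rewrite -?expr2 ?ax; ring.
Qed.

Lemma family_nnmm_companion n m ps (rho : C) p :
  family_nnmm n m ps rho -> p \in ps ->
  has_hypergeometric_companion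
    (reflection_group p rho (twocos R n) (twocos R n)).
Proof.
have pi0 := pi_gt0 R; rewrite /twocos.
have [c2 c0 c1] := cos_pi5 R.
have b2 : Num.sqrt 3 ^+ 2 = 3 :> R by rewrite sqr_sqrtr.
have b0 : 0 < Num.sqrt 3 :> R by rewrite sqrtr_gt0.
case=> pp.
- have pq : 4%:Z <= p by exact: all_ge pp _.
  rewrite /expi cos_pi3 sin_pi3; apply: isosceles_companion_real; [lra|nra|].
  apply: (isosceles_mirror_det (q := 4)) => //; rewrite ?cos_pi4; nra.
- have pq : 3%:Z <= p by exact: all_ge pp _.
  have s7 : Num.sqrt 7 ^+ 2 = 7 :> R by rewrite sqr_sqrtr.
  have s0 : 0 < Num.sqrt 7 :> R by rewrite sqrtr_gt0.
  have -> : (1 + 'i%C * (Num.sqrt 7)%:C) / 2 = (1 / 2) +i* (Num.sqrt 7 / 2) :> C.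
    by rewrite half_complex /=; congr (_ +i* _); ring.
  rewrite cos_pi3; apply: isosceles_companion_real; [lra|nra|].
  apply: (isosceles_mirror_det (q := 3)) => //; rewrite ?cos_pi3; nra.
- (* sqrt (rho + rho^* ) = 1 for rho = - exp (-2 i x) - exp (-4 i x) and
     x = pi / 5; for p = -5 the two terms of the criterion have opposite signs. *)
  set c := cos (pi / 5) in c2 c0 c1 *; pose s : R := sin (pi / 5).
  have s0 : 0 < s by apply: sin_gt0_pi; lra.
  have cs : s ^+ 2 = 1 - c ^+ 2.
    by have := cos2Dsin2 (pi / 5 : R); rewrite -/c -/s; lra.
  have Er : - expi (- (2 * pi / 5)) - expi (- (4 * pi / 5)) =
      (1 / 2) +i* (s * (1 + 2 * c)) :> C.
    rewrite /expi !cosN !sinN.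
    rewrite (_ : 4 * pi / 5 = pi - pi / 5); last by field.
    rewrite (_ : 2 * pi / 5 = 2 * (pi / 5)); last by field.
    rewrite cos_pi_sub sin_pi_sub cos_double sin_double -/c -/s; simpc.
    by congr (_ +i* _); nra.
  rewrite Er (_ : 2 * cos (pi / 3%:R) = 1); last by rewrite cos_pi3; field.
  apply: isosceles_companion_real; [lra|nra|].
  have S2 : (s * (1 + 2 * c)) ^+ 2 = (3 + 8 * c) / 4 by rewrite exprMn cs; nra.
  have [/eqP -> |p5] := boolP (p == - 5).
    apply: (@mirror_det_neq0 _ _ _ _ _ (3 + 2 * c) (1 / 2) (s * (1 + 2 * c))).
    - by rewrite complex_norm2 S2; simpc; congr (_ +i* _); field.
    - by simpc; congr (_ +i* _); ring.
    rewrite (_ : pi / (- 5)%:~R = - (pi / 5)) ?sinN ?cosN -/s -/c; last by field.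
    rewrite (_ : _ + _ = s * (1 - 2 * c)); last by rewrite sqrrN cs; nra.
    by rewrite mulf_neq0 //; apply/eqP; lra.
  have pq : 2%:Z <= p.
    have : p \in [:: 2; 3; 5; 10 : int].
      by move: pp p5; rewrite !inE; do !case: eqP => //=.
    by move/all_ge; apply.
  apply: (isosceles_mirror_det (q := 2)) => //; rewrite ?cos_pihalf ?S2; nra.
- have pq : 4%:Z <= p by exact: all_ge pp _.
  have cc := cos_pi4 R.
  have c40 : 0 < cos (pi / 4 : R) by apply: cos_gt0_lt; lra.
  rewrite -[1 : C]/(1 +i* 0); apply: isosceles_companion_real; [lra|nra|].
  apply: (isosceles_mirror_det (q := 4)) => //; nra.
- have pq : 3%:Z <= p by exact: all_ge pp _.
  have cc := cos_pi4 R.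
  have c40 : 0 < cos (pi / 4 : R) by apply: cos_gt0_lt; lra.
  have -> : 1 + 'i%C = 1 +i* 1 :> C by simpc.
  apply: isosceles_companion_real; [lra|nra|].
  apply: (isosceles_mirror_det (q := 3)) => //; rewrite ?cos_pi3; nra.
- have pq : 3%:Z <= p by exact: all_ge pp _.
  set c := cos (pi / 5) in c2 c0 c1 *.
  have -> : expi (pi / 3) * ((Num.sqrt 5)%:C - 'i%C * (Num.sqrt 3)%:C) / 2 =
      (c + 1 / 2) +i* (Num.sqrt 3 * (2 * c - 1) / 2) :> C.
    rewrite half_complex /= cos_pi3 sin_pi3 sqrt5E -/c.
    by congr (_ +i* _); field: b2.
  apply: isosceles_companion_real; [lra|nra|].
  apply: (isosceles_mirror_det (q := 3)) => //; rewrite ?cos_pi3.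
    by rewrite divr_ge0 // mulr_ge0 //; lra.
  have -> : (Num.sqrt 3 * (2 * c - 1) / 2) ^+ 2 = 3 * (2 * c - 1) ^+ 2 / 4.
    by rewrite !exprMn b2; field.
  by nra.
- have pq : 2%:Z <= p by exact: all_ge pp _.
  set c := cos (pi / 5) in c2 c0 c1 *.
  pose s : R := sin (2 * pi / 5).
  have s0 : 0 < s by apply: sin_gt0_pi; lra.
  have Ec : cos (2 * pi / 5) = 2 * c ^+ 2 - 1 :> R.
    by rewrite -cos_double; congr cos; field.
  have cs := cos2Dsin2 (2 * pi / 5 : R); rewrite Ec -/s in cs.
  have -> : expi (2 * pi / 5) + 1 = (2 * c ^+ 2) +i* s :> C.
    by rewrite /expi Ec -/s; simpc; congr (_ +i* _); ring.
  apply: isosceles_companion_real; [lra|nra|].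
  apply: (isosceles_mirror_det (q := 2)) => //; rewrite ?cos_pihalf; nra.
Qed.

Lemma family_334n_companion n ps (rho : C) p :
  family_334n n ps rho -> p \in ps ->
  has_hypergeometric_companion (reflection_group p rho 1 1).
Proof.
have pi0 := pi_gt0 R.
have [c2 c0 c1] := cos_pi5 R.
have b2 : Num.sqrt 3 ^+ 2 = 3 :> R by rewrite sqr_sqrtr.
have b0 : 0 < Num.sqrt 3 :> R by rewrite sqrtr_gt0.
have s7 : Num.sqrt 7 ^+ 2 = 7 :> R by rewrite sqr_sqrtr.
have s70 : 0 < Num.sqrt 7 :> R by rewrite sqrtr_gt0.
have s2 : Num.sqrt 2 ^+ 2 = 2 :> R by rewrite sqr_sqrtr.
have s20 : 0 < Num.sqrt 2 :> R by rewrite sqrtr_gt0.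
have E4 (x y : R) : x ^+ 2 + y ^+ 2 = 2 ->
    (x +i* y) * (x +i* y)^*%C + 1 * 1^*%C + 1 * 1^*%C = (4 : R)%:C.
  by move=> xy; rewrite complex_norm2 xy conjc1; simpc; congr (_ +i* _); ring.
have E2 (x y : R) : x ^+ 2 + y ^+ 2 = 2 -> (x +i* y) * (x +i* y)^*%C = 2.
  by move=> xy; rewrite complex_norm2 xy rmorph_nat.
case=> pp.
- have pq : 3%:Z <= p by exact: all_ge pp _.
  have -> : 1 + 'i%C = 1 +i* 1 :> C by simpc.
  apply: braid_334_companion; first by apply: E2; lra.
  apply: (@mirror_det_neq0_gt0 _ _ _ _ _ 4 1 1 pq);
    [by apply: E4; lra | by rewrite !mulr1 | lra | lra].
- have pq : 3%:Z <= p by exact: all_ge pp _.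
  have -> : (1 + 'i%C * (Num.sqrt 7)%:C) / 2 = (1 / 2) +i* (Num.sqrt 7 / 2) :> C.
    by rewrite half_complex /=; congr (_ +i* _); ring.
  apply: braid_334_companion; first by apply: E2; nra.
  apply: (@mirror_det_neq0_ge0 _ 3 _ _ _ _ 4 (1 / 2) (Num.sqrt 7 / 2) isT pq);
    [by apply: E4; nra | by rewrite !mulr1 | lra | rewrite cos_pi3; lra].
- have pq : 3%:Z <= p by exact: all_ge pp _.
  set c := cos (pi / 5) in c2 c0 c1 *.
  have -> : expi (2 * pi / 3) * ((Num.sqrt 5)%:C - 'i%C * (Num.sqrt 3)%:C) / 2 =
      (1 - c) +i* (Num.sqrt 3 * c) :> C.
    rewrite half_complex (_ : 2 * pi / 3 = pi - pi / 3); last by field.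
    rewrite /= cos_pi_sub sin_pi_sub cos_pi3 sin_pi3 sqrt5E -/c.
    by congr (_ +i* _); field: b2.
  have n2 : (1 - c) ^+ 2 + (Num.sqrt 3 * c) ^+ 2 = 2 by rewrite exprMn b2; nra.
  apply: braid_334_companion; first exact: E2.
  apply: (@mirror_det_neq0_ge0 _ 3 _ _ _ _ 4 (1 - c) (Num.sqrt 3 * c) isT pq);
    [exact: E4 | by rewrite !mulr1 | by rewrite mulr_ge0 //; lra |].
  by rewrite cos_pi3; lra.
- have pq : 3%:Z <= p by exact: all_ge pp _.
  have -> : 'i%C * (Num.sqrt 2)%:C = 0 +i* Num.sqrt 2 :> C by simpc.
  apply: braid_334_companion; first by apply: E2; nra.
  apply: (@mirror_det_neq0_ge0 _ 3 _ _ _ _ 4 0 (Num.sqrt 2) isT pq);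
    [by apply: E4; nra | by rewrite !mulr1 | lra | rewrite cos_pi3; lra].
- (* Y < 0 here.  If the determinant vanished, squaring would remove the
     irrational factor sqrt 7 sin (pi / 7) and leave a second polynomial equation
     for k = cos (pi / 7), which has no root in common with its cubic. *)
  have [k0 k3] := cos_pi7 R; set k := cos (pi / 7) in k0 k3.
  pose l : R := sin (pi / 7).
  have kl : l ^+ 2 = 1 - k ^+ 2.
    by have := cos2Dsin2 (pi / 7 : R); rewrite -/k -/l; lra.
  set b := Num.sqrt 7 in s7 s70 *.
  have -> : expi (6 * pi / 7) * (- 1 + 'i%C * b%:C) / 2 =
      ((k - b * l) / 2) +i* (- (l + b * k) / 2) :> C.
    rewrite half_complex (_ : 6 * pi / 7 = pi - pi / 7); last by field.
    rewrite /= cos_pi_sub sin_pi_sub -/k -/l.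
    by congr (_ +i* _); ring.
  have n2 : ((k - b * l) / 2) ^+ 2 + (- (l + b * k) / 2) ^+ 2 = 2.
    by field: s7 kl.
  apply: braid_334_companion; first exact: E2.
  apply: (mirror_det_neq0 (E4 _ _ n2)); first by rewrite !mulr1.
  move: pp; rewrite !inE => /orP[|] /eqP ->.
    rewrite [pi / _]/(pi / 2) cos_pihalf sin_pihalf; apply/eqP => H.
    have kb : k = b * l by lra.
    have : k ^+ 2 = 7 * (1 - k ^+ 2) by rewrite {1}kb exprMn s7 kl.
    nra.
  rewrite [pi / _]/(pi / 7) -/k -/l; apply/eqP => H.
  have H1 : 2 * (l * k * (4 * k - 1)) = b * (2 * k ^+ 2 - 1).
    have l3 : l ^+ 3 = l * (1 - k ^+ 2) by rewrite exprS kl.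
    have bl : b * l ^+ 2 = b * (1 - k ^+ 2) by rewrite kl.
    lra.
  have H2 : 4 * (1 - k ^+ 2) * k ^+ 2 * (4 * k - 1) ^+ 2 =
      7 * (2 * k ^+ 2 - 1) ^+ 2.
    by rewrite -s7 -kl -exprMn -H1; ring.
  (* - 3 - 8 k^3 is the quotient of H2 by the cubic. *)
  have k2 : 5 * k ^+ 2 = 3 * k + 1.
    have : (8 * k ^+ 3 - (4 * k ^+ 2 + 4 * k - 1)) * (- 3 - 8 * k ^+ 3) = 0.
      by rewrite k3 subrr mul0r.
    lra.
  have k3' : 25 * k ^+ 3 = 14 * k + 3.
    have : k * (5 * k ^+ 2) = k * (3 * k + 1) by rewrite k2.
    lra.
  have k1 : k = 29 / 48 by lra.
  by move: k2; rewrite k1; lra.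
Qed.

Lemma family_23nn_companion n (ps : seq int) p :
  (n, ps) \in
      [:: (3%N, [:: 5; 6; 7; 8; 9; 10; 12; 18] : seq int);
          (4%N, [:: 4; 5; 6; 8; 12]);
          (5%N, [:: 3; 4; 5; 10]);
          (6%N, [:: 3; 4; 6])] -> p \in ps ->
  has_hypergeometric_companion (reflection_group p (twocos R n) 0 1).
Proof.
have pi0 := pi_gt0 R; rewrite /twocos.
have [c2 c0 c1] := cos_pi5 R.
have row (q : nat) (a : R) : (1 < q)%N -> q%:Z <= p -> 0 < a ->
    4 * (1 - cos (pi / q%:R) ^+ 2) < a ^+ 2 + 1 ->
    has_hypergeometric_companion (reflection_group p a%:C 0 1).
  move=> q1 qp a0 aq; apply: braid_23nn_companion.
  - exact: conjc_real.
  - by rewrite eq_complex /= gt_eqF.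
  apply: (@mirror_det_neq0_ge0 _ q p _ _ _ (a ^+ 2 + 1) 0 0 q1 qp) => //.
  - by rewrite conjc0 conjc1 conjc_real; simpc; congr (_ +i* _); ring.
  - by rewrite mulr0 mul0r.
  - lra.
rewrite !inE => /orP[|/orP[|/orP[|]]] /eqP[-> ->] pp.
- have pq : 5%:Z <= p by exact: all_ge pp _.
  by apply: (row 5%N) => //; rewrite cos_pi3; nra.
- have pq : 4%:Z <= p by exact: all_ge pp _.
  have cc := cos_pi4 R.
  have c40 : 0 < cos (pi / 4 : R) by apply: cos_gt0_lt; lra.
  by apply: (row 4%N) => //; nra.
- have pq : 3%:Z <= p by exact: all_ge pp _.
  by apply: (row 3%N) => //; rewrite ?cos_pi3; nra.
- have pq : 3%:Z <= p by exact: all_ge pp _.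
  have cc := cos_pi6 R.
  have c60 : 0 < cos (pi / 6 : R) by apply: cos_gt0_lt; lra.
  by apply: (row 3%N) => //; rewrite ?cos_pi3; nra.
Qed.

Lemma E2_4_companion :
  has_hypergeometric_companion
    (reflection_group 4 (Num.sqrt 2)%:C (expi (pi / 3)) (Num.sqrt 2)%:C
      : set (PGL C 3)).
Proof.
have b2 : Num.sqrt 3 ^+ 2 = 3 :> R by rewrite sqr_sqrtr.
have s2 : Num.sqrt 2 ^+ 2 = 2 :> R by rewrite sqr_sqrtr.
rewrite /expi cos_pi3 sin_pi3; apply: E2_companion.
- rewrite /zeta (_ : 2 * pi / 4%:~R = pi / 2) /expi ?cos_pihalf ?sin_pihalf.
    exact: sqr_i.
  by field.
- exact: conjc_real.
- by rewrite -rmorphXn s2 rmorph_nat.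
- by rewrite expr2; simpc; congr (_ +i* _); field: b2.
- by simpc; congr (_ +i* _); field.
Qed.

End Rows.

Theorem theorem1p1 (R : realType) (s : braiding) (p : int)
    (rho sigma tau : R[i]%C)
    (Hlist : DPP_lattice s p rho sigma tau)
    (Hexcl : ~ excluded s p) :
  exists (alpha beta : 'I_3 -> R[i]%C) (M : set (PGL R[i]%C 3)),
    hypergeometric_monodromy alpha beta M /\
    commensurable (reflection_group p rho sigma tau) M.
Proof.
case: Hlist Hexcl => {s p rho sigma tau}.
- move=> n m ps tau p row pp _; apply: equilateral_companion.
  exact: family_nnnm_mirror_det row pp.
- by move=> n m ps rho p row pp _; exact: family_nnmm_companion row pp.
- by move=> n ps rho p row pp _; exact: family_334n_companion row pp.
- by move=> n ps p row pp _; exact: family_23nn_companion row pp.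
move=> p; rewrite !inE => pp ex; suff -> : p = 4 by exact: E2_4_companion.
by move: pp; do !case: eqP => //= ?; move=> _; case: ex; split=> //; subst p.
Qed.
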